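(* Let $p$ be a prime and $t$ an integer, and suppose that either $p\geq 5$ and $t\geq 2$, or $p=3$ and $t\geq 3$. Let $\mathcal S(\mathbb Z_{p^t})$ denote the set of all determinants of $p^t\times p^t$ circulant matrices with integer entries. Then $p^{2t}\mathbb Z\subseteq \mathcal S(\mathbb Z_{p^t})$, but $p^j\notin \mathcal S(\mathbb Z_{p^t})$ for every integer $j$ with $t+1\leq j\leq 2t-1$. Moreover, suppose that $p^j m\in \mathcal S(\mathbb Z_{p^t})$ where $m$ is an integer with $p\nmid m$ and $t+1\leq j\leq 2t-1$. (a) If $p\geq 5$, or $p=3$ and $j>t+1$, then there exist $2t-j$ prime powers $q_1^{a_1},\dots,q_{2t-j}^{a_{2t-j}}$ (each $q_i$ prime) with $q_i^{a_i}\equiv 1 \pmod{p^i}$ and each $a_i$ odd, such that $\prod_{i=1}^{2t-j} q_i^{a_i}$ divides $m$. (b) If $p=3$ and $j=t+1$, then there exist $t-2$ prime powers $q_2^{a_2},\dots,q_{t-1}^{a_{t-1}}$ (each $q_i$ prime) with $q_i^{a_i}\equiv 1 \pmod{3^i}$ and each $a_i$ odd, such that $\prod_{i=2}^{t-1} q_i^{a_i}$ divides $m$.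
   Context: A circulant matrix with first row $(a_0,\dots,a_{n-1})$ has $(r,s)$ entry $a_{(s-r)\bmod n}$. Its determinant equals $M_n(F)=\prod_{z^n=1}F(z)$ where $F(x)=\sum_{j=0}^{n-1}a_jx^j$; so $\mathcal S(\mathbb Z_n)=\{M_n(F): F\in\mathbb Z[x]\}$. *)

(* Defs.v *)
From mathcomp Require Import all_boot all_order all_algebra.
Set Implicit Arguments. Unset Strict Implicit. Unset Printing Implicit Defensive.
Import Order.TTheory GRing.Theory Num.Theory.
Local Open Scope ring_scope.

(* The n x n circulant matrix with first row (a 0, ..., a (n-1)):
   its (r,s) entry is a ((s - r) mod n).  Values a k for k >= n are unused. *)
Definition circulant (n : nat) (a : nat -> int) : 'M[int]_n :=
  \matrix_(r < n, s < n) a ((s + n - r) %% n)%N.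

Definition circ_dets (n : nat) (d : int) : Prop :=
  exists a : nat -> int, \det (circulant n a) = d.

(* Main.v *)
(* Write M = prod_{k <= t} N_k, where N_k is the norm of alpha_k = F(zeta_k), zeta_k of order p^k.
   If p | M and the valuation of M is at most 2t, then every N_k is divisible by p and F'(1) is prime
   to p.  Fix k >= 1.  If every prime q <> p dividing N_k has even order mod p^k, then complex
   conjugation acts on Z[zeta_k]/q as a power of Frobenius, so the ideal (alpha_k) is stable under
   conjugation and conj(alpha_k) / alpha_k is a unit of absolute value 1, i.e. +- a power of zeta_k;
   the sign is - because F'(1) is prime to p.  Otherwise some q of odd order f satisfies q^f | N_k.
   The levels k of the first kind are few: after translating F by a power of x, the polynomial
   F(x) + F(1/x) vanishes at all the corresponding zeta_k (up to an exception for p = 3, k = 1),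
   hence is divisible by the product of their cyclotomic polynomials, and evaluation at 1 shows that
   their number is at most the valuation of F(1). *)
Require Import Defs.
From mathcomp Require Import all_boot all_order all_algebra.
From mathcomp Require Import cyclic all_field.
From mathcomp Require Import ring zify.
Import Order.TTheory GRing.Theory Num.Theory.
Set Implicit Arguments. Unset Strict Implicit. Unset Printing Implicit Defensive.
Local Open Scope ring_scope.

(** * Values of integer polynomials and congruences in Z[z] *)

(** No factorization of ideals is used: a statement local at q is made in Z[z] up to a multiplier 1
    + q r, and the local statements are glued by a Bezout argument. At p everything is governed by
    F'(1) mod p. Once p divides F(1), 1 - zeta_k divides alpha_k, and does so twice exactly when p
    divides F'(1). Hence p divides every N_k, and p | F'(1) would push the valuation of M up to 2t +
    1. The exception comes from valuations at 1 - zeta_k. At a level of the first kind the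
    symmetrized value is 1 - zeta_k^e times an element of valuation 1: it is zero or of valuation at
    most p^(k-1) + 1, whereas p has valuation p^(k-1) (p - 1). The former is smaller unless p = 3
    and k = 1, where both are 2. If M has valuation j, then F(1) has valuation at most j - t, so at
    least 2t - j levels yield a prime power. Which levels these are is not controlled; the i-th of
    them is at least i, whence a congruence modulo p^i only. *)

Definition ev (F : {poly int}) (x : algC) : algC := (map_poly intr F).[x].

Lemma evD F G x : ev (F + G) x = ev F x + ev G x.
Proof. by rewrite /ev rmorphD hornerD. Qed.
Lemma evN F x : ev (- F) x = - ev F x.
Proof. by rewrite /ev rmorphN hornerN. Qed.
Lemma evB F G x : ev (F - G) x = ev F x - ev G x.
Proof. by rewrite evD evN. Qed.
Lemma evM F G x : ev (F * G) x = ev F x * ev G x.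
Proof. by rewrite /ev rmorphM hornerM. Qed.
Lemma evC c x : ev c%:P x = c%:~R.
Proof. by rewrite /ev map_polyC hornerC. Qed.
Lemma ev0 x : ev 0 x = 0.
Proof. by rewrite /ev map_poly0 horner0. Qed.
Lemma evX x : ev 'X x = x.
Proof. by rewrite /ev map_polyX hornerX. Qed.
Lemma ev1 x : ev 1 x = 1.
Proof. by rewrite /ev rmorph1 hornerC. Qed.
Lemma evXn n x : ev 'X^n x = x ^+ n.
Proof. by rewrite /ev map_polyXn hornerXn. Qed.
Lemma ev_exp F n x : ev (F ^+ n) x = ev F x ^+ n.
Proof. by rewrite /ev rmorphXn horner_exp. Qed.
Lemma evZ c F x : ev (c *: F) x = c%:~R * ev F x.
Proof. by rewrite -mul_polyC evM evC. Qed.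
Lemma ev_comp F G x : ev (F \Po G) x = ev F (ev G x).
Proof. by rewrite /ev map_comp_poly horner_comp. Qed.
Lemma ev_sum I (r : seq I) (P : pred I) (F : I -> {poly int}) x :
  ev (\sum_(i <- r | P i) F i) x = \sum_(i <- r | P i) ev (F i) x.
Proof. by rewrite /ev rmorph_sum horner_sum. Qed.
Lemma ev_prod I (r : seq I) (P : pred I) (F : I -> {poly int}) x :
  ev (\prod_(i <- r | P i) F i) x = \prod_(i <- r | P i) ev (F i) x.
Proof. by rewrite /ev rmorph_prod horner_prod. Qed.
Lemma ev_int F (c : int) : ev F c%:~R = (F.[c])%:~R.
Proof. by rewrite /ev horner_map. Qed.
Lemma ev_at1 F : ev F 1 = (F.[1])%:~R.
Proof. by rewrite -ev_int. Qed.
Lemma ev_rmorph (u : {rmorphism algC -> algC}) F x : u (ev F x) = ev F (u x).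
Proof.
rewrite /ev -horner_map /= -map_poly_comp; congr _.[_].
by apply: eq_map_poly => c /=; rewrite rmorph_int.
Qed.
Definition evE := (evD, evB, evN, evM, evC, evXn, evX, ev1, ev_exp, ev_comp, evZ).

(** Elements of Z[z] come with a polynomial, so that automorphisms and Frobenius become
    substitutions of a power of [z]. *)
Definition ZZ (z x : algC) := exists F, x = ev F z.

Section Closure.
Variable z : algC.
Lemma ZZ_ev F : ZZ z (ev F z). Proof. by exists F. Qed.
Lemma ZZ_gen : ZZ z z. Proof. by exists 'X; rewrite evX. Qed.
Lemma ZZ_int c : ZZ z c%:~R. Proof. by exists c%:P; rewrite evC. Qed.
Lemma ZZ_nat n : ZZ z n%:R. Proof. by exists n%:Z%:P; rewrite evC. Qed.
Lemma ZZ1 : ZZ z 1. Proof. exact: (ZZ_nat 1). Qed.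
Lemma ZZ0 : ZZ z 0. Proof. exact: (ZZ_nat 0). Qed.
Lemma ZZD x y : ZZ z x -> ZZ z y -> ZZ z (x + y).
Proof. by move=> [F ->] [G ->]; exists (F + G); rewrite evD. Qed.
Lemma ZZN x : ZZ z x -> ZZ z (- x).
Proof. by move=> [F ->]; exists (- F); rewrite evN. Qed.
Lemma ZZM x y : ZZ z x -> ZZ z y -> ZZ z (x * y).
Proof. by move=> [F ->] [G ->]; exists (F * G); rewrite evM. Qed.
Lemma ZZX x n : ZZ z x -> ZZ z (x ^+ n).
Proof. by move=> [F ->]; exists (F ^+ n); rewrite ev_exp. Qed.
Lemma ZZ_prod I (r : seq I) (P : pred I) (f : I -> algC) :
  (forall i, P i -> ZZ z (f i)) -> ZZ z (\prod_(i <- r | P i) f i).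
Proof. by move=> H; elim/big_ind: _ => //; [exact: ZZ1 | exact: ZZM]. Qed.
Lemma ZZ_sub y x : ZZ z y -> ZZ y x -> ZZ z x.
Proof. by move=> [F ->] [G ->]; exists (G \Po F); rewrite ev_comp. Qed.
Lemma ZZ_Aint x : z \in Aint -> ZZ z x -> x \in Aint.
Proof.
move=> zA [F ->]; rewrite /ev horner_coef rpred_sum // => i _.
by rewrite rpredM ?rpredX // coef_map Aint_int.
Qed.
End Closure.

Create HintDb zz.
#[local] Hint Resolve ZZ_ev ZZ_gen ZZ_int ZZ_nat ZZ1 ZZ0 ZZD ZZN ZZM ZZX : zz.
Ltac zz := solve [auto 30 with zz].

Lemma Aint_dvdz (q : nat) (d : int) (x : algC) :
  q != 0%N -> x \in Aint -> d%:~R = q%:R * x -> (q%:Z %| d)%Z.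
Proof.
move=> q0 xA dE.
have q0' : q%:R != 0 :> algC by rewrite pnatr_eq0.
have xE : x = d%:~R / q%:R by rewrite dE mulrC mulKf.
have /intrP[m mE] : x \in Num.int.
  apply: Cint_rat_Aint xA; rewrite xE rpred_div ?rpred_int ?rpred_nat //.
apply/dvdzP; exists m; apply: (@intr_inj algC).
by rewrite dE mE rmorphM /= mulrC.
Qed.

Lemma poly_Fp_frobenius (q : nat) (F : {poly 'F_q}) : prime q ->
  F ^+ q = F \Po 'X^q.
Proof.
move=> q_pr; have chX : q \in [pchar {poly 'F_q}].
  by rewrite (rmorph_pchar polyC) ?pchar_Fp.
elim/poly_ind: F => [|F c IH]; first by rewrite comp_poly0 expr0n gtn_eqF ?prime_gt0.
rewrite comp_polyD comp_polyM comp_polyX comp_polyC -IH.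
rewrite -!(pFrobenius_autE chX) pFrobenius_autD_comm; last exact: mulrC.
rewrite pFrobenius_autM_comm; last exact: mulrC.
have cq : c ^+ q = c by have := expf_card c; rewrite card_Fp.
by rewrite !pFrobenius_autE -polyC_exp cq.
Qed.

Lemma poly_frobenius (q : nat) (F : {poly int}) : prime q ->
  exists G, F ^+ q = (F \Po 'X^q) + q%:Z *: G.
Proof.
move=> q_pr; have chq := pchar_Fp q_pr.
pose P := F ^+ q - (F \Po 'X^q).
have PE : map_poly (intr : int -> 'F_q) P = 0.
  apply/eqP; rewrite /P rmorphB /= subr_eq0 rmorphXn.
  by rewrite map_comp_poly map_polyXn poly_Fp_frobenius.
have Pd i : (q%:Z %| P`_i)%Z.
  by rewrite (dvdz_pcharf chq) -coef_map PE coef0.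
have /polyOver_dvdzP[G PG] : P \is a polyOver (dvdz q) by apply/polyOverP.
by exists G; rewrite -PG addrC subrK.
Qed.

Definition eqq (z : algC) (q : nat) (x y : algC) :=
  exists2 r, ZZ z r & x = y + q%:R * r.

Lemma eqq_refl z q x : eqq z q x x.
Proof. by exists 0; [zz | ring]. Qed.
Lemma eqq_trans z q y x w : eqq z q x y -> eqq z q y w -> eqq z q x w.
Proof. by move=> [r Hr ->] [s Hs ->]; exists (s + r); [zz | ring]. Qed.
Lemma eqqM z q x1 y1 x2 y2 : ZZ z y1 -> ZZ z y2 ->
  eqq z q x1 y1 -> eqq z q x2 y2 -> eqq z q (x1 * x2) (y1 * y2).
Proof.
move=> H1 H2 [r Hr ->] [s Hs ->].
by exists (r * y2 + s * y1 + q%:R * r * s); [zz | ring].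
Qed.
Lemma eqqX z q x y n : ZZ z y -> eqq z q x y -> eqq z q (x ^+ n) (y ^+ n).
Proof.
move=> Hy H; elim: n => [|n IH]; first by rewrite !expr0; exact: eqq_refl.
by rewrite !exprS; apply: eqqM => //; zz.
Qed.
Lemma eqq_prod z q (I : Type) (r : seq I) (P : pred I) (f g : I -> algC) :
  (forall i, P i -> ZZ z (g i)) -> (forall i, P i -> eqq z q (f i) (g i)) ->
  eqq z q (\prod_(i <- r | P i) f i) (\prod_(i <- r | P i) g i).
Proof.
move=> Hg H.
pose K x y := ZZ z y /\ eqq z q x y.
suff [] : K (\prod_(i <- r | P i) f i) (\prod_(i <- r | P i) g i) by [].
elim/big_ind2: _ => [|x1 x2 y1 y2 [H1 H2] [H3 H4]|i Pi].
- by split; [zz | exact: eqq_refl].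
- by split; [zz | exact: eqqM].
- by split; [exact: Hg | exact: H].
Qed.

Lemma frobenius z q F : prime q -> eqq z q (ev F z ^+ q) (ev F (z ^+ q)).
Proof.
move=> q_pr; have [G GE] := poly_frobenius F q_pr.
exists (ev G z); first zz.
by rewrite -ev_exp GE !evE.
Qed.

Lemma frobenius_iter z q F i : prime q ->
  eqq z q (ev F z ^+ (q ^ i)) (ev F (z ^+ (q ^ i))).
Proof.
move=> q_pr; elim: i => [|i IH]; first by rewrite !expn0 !expr1; exact: eqq_refl.
rewrite expnSr !exprM.
have Hz : ZZ z (ev F (z ^+ (q ^ i))).
  by exists (F \Po 'X^(q ^ i)); rewrite !evE.
apply: eqq_trans (eqqX q Hz IH) _.
have -> : ev F (z ^+ (q ^ i)) = ev (F \Po 'X^(q ^ i)) z by rewrite !evE.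
apply: eqq_trans (frobenius _ _ q_pr) _.
by rewrite !evE -!exprM mulnC; exact: eqq_refl.
Qed.

Lemma eqq_int z q (a b : int) : z \in Aint -> q != 0%N ->
  eqq z q a%:~R b%:~R -> (a == b %[mod q])%Z.
Proof.
move=> zA q0 [r Hr E]; rewrite eqz_mod_dvd.
apply: (@Aint_dvdz _ _ r) => //; first exact: ZZ_Aint Hr.
by rewrite rmorphB /= E addrAC subrr add0r.
Qed.

(** * Local divisibility of conjugates *)

(* Where [a = alpha ^+ h.+1] is idempotent mod [q], the element [e = 3 a^2 - 2 a^3]
   is idempotent mod [q^2]; [e + q (1 - e)] then generates locally the product of
   the primes above [q] dividing [alpha], and it can be split off from [alpha]. *)
Lemma conj_locally_divisible z q c h (s : {rmorphism algC -> algC}) :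
  (q > 0)%N -> (c > 0)%N ->
  (forall x, ZZ z x -> ZZ z (s x)) ->
  (forall x, ZZ z x -> eqq z q (x ^+ c) (s x)) ->
  (forall x, ZZ z x -> eqq z q (x ^+ h.+2) x) ->
  forall N al al' d, ZZ z al -> ZZ z al' -> ZZ z d ->
    al * al' = q%:R ^+ N * (1 + q%:R * d) ->
  exists r be, [/\ ZZ z r, ZZ z be & (1 + q%:R * r) * s al = al * be].
Proof.
move=> q_gt0 c_gt0 sZ sF hF; have q0 : q%:R != 0 :> algC by rewrite pnatr_eq0 -lt0n.
set Q := q%:R in q0 *; have QZ : ZZ z Q by exact: ZZ_nat.
elim=> [|N IH] al al' d Ha Ha' Hd E.
  exists d, (al' * s al); split; [zz | by apply: ZZM; auto|].
  by rewrite mulrA E expr0 mul1r.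
have [t Ht Et] := hF al Ha.
pose a := al ^+ h.+1.
have aZ : ZZ z a by rewrite /a; zz.
have ala : al * a = al + Q * t by rewrite /a -exprS Et.
have a2 : a ^+ 2 - a = Q * (al ^+ h * t).
  have -> : a ^+ 2 = al ^+ h * (al * a) by rewrite /a !exprS; ring.
  by rewrite ala /a !exprS; ring.
pose u := al ^+ h * t.
have uZ : ZZ z u by rewrite /u; zz.
pose e := 3%:R * a ^+ 2 - 2%:R * a ^+ 3.
have eZ : ZZ z e by rewrite /e; zz.
pose ep := - (u ^+ 2 * (4%:R * a ^+ 2 - 4%:R * a - 3%:R)).
have epZ : ZZ z ep by rewrite /ep; zz.
have eE : e * (1 - e) = Q ^+ 2 * ep.
  have -> : e * (1 - e) = - ((a ^+ 2 - a) ^+ 2 * (4%:R * a ^+ 2 - 4%:R * a - 3%:R)).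
    by rewrite /e; ring.
  by rewrite a2 /ep /u; ring.
(* Modulo [q], [g] and [g'] are complementary idempotents. As [g * g'] is [q] times a local unit,
   dividing by [g] means multiplying by [g'] and cancelling [q]. *)
pose g := e + Q * (1 - e); pose g' := (1 - e) + Q * e.
have gZ : ZZ z g by rewrite /g; zz.
have g'Z : ZZ z g' by rewrite /g'; zz.
pose w0 := ep * (1 + Q ^+ 2) - 2%:R * Q * ep.
have w0Z : ZZ z w0 by rewrite /w0; zz.
have gg' : g * g' = Q * (1 + Q * w0).
  have -> : g * g' = e * (1 - e) * (1 + Q ^+ 2) + Q * (1 - 2%:R * (e * (1 - e))).
    by rewrite /g /g'; ring.
  by rewrite eE /w0; ring.
pose al1 := - t * (1 - a) * (1 + 2%:R * a) + al * e.
have al1Z : ZZ z al1 by rewrite /al1; zz.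
have al1E : al * g' = Q * al1.
  have -> : al * g' = (al - al * a) * (1 - a) * (1 + 2%:R * a) + Q * (al * e).
    by rewrite /g' /e; ring.
  by rewrite ala /al1; ring.
pose al1' := Q ^+ N * (1 + Q * d) * al ^+ h * a * (3%:R - 2%:R * a) + (1 - e) * al'.
have al1'Z : ZZ z al1' by rewrite /al1'; zz.
have al1'E : g * al' = Q * al1'.
  have -> : g * al' = (al * al') * al ^+ h * a * (3%:R - 2%:R * a) + Q * ((1 - e) * al').
    by rewrite /g /e /a !exprS; ring.
  by rewrite E /al1' exprS; ring.
have [||r1 [be1 [Hr1 Hb1 E1]]] := IH al1 al1' (w0 + d + Q * w0 * d) al1Z al1'Z.
- zz.
- apply: (mulfI q0); apply: (mulfI q0).
  have -> : Q * (Q * (al1 * al1')) = (al * al') * (g * g').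
    by transitivity ((Q * al1) * (Q * al1')); [ring | rewrite -al1E -al1'E; ring].
  by rewrite E gg' exprS; ring.
clearbody e w0; have [v Hv Ev] := sF e eZ.
(* Modulo [q], [s e] is [e ^+ c], which [1 - e] kills: locally, [g] divides [s g]. *)
have sgE : exists2 f, ZZ z f & g' * s g = Q * f.
  exists (Q * ep * e ^+ c.-1 - (1 - e) * v + e * s g + (1 - e) * (1 - s e)); last first.
    have -> : g' * s g = (1 - e) * s e + Q * (e * s g + (1 - e) * (1 - s e)).
      have sg : s g = s e + Q * (1 - s e).
        by rewrite /g rmorphD /= rmorphM /= rmorphB /= rmorph1 /Q rmorph_nat.
      by rewrite /g' sg; ring.
    have -> : s e = e * e ^+ c.-1 - Q * v by rewrite -exprS prednK // Ev; ring.
    have -> : (1 - e) * (e * e ^+ c.-1 - Q * v) = (e * (1 - e)) * e ^+ c.-1 - Q * (1 - e) * v by ring.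
    by rewrite eE; ring.
  by have := sZ e eZ; have := sZ g gZ => *; zz.
case: sgE => f Hf Ef.
exists (r1 + s w0 + Q * r1 * s w0), (f * be1); split.
- by have := sZ w0 w0Z => *; zz.
- zz.
apply: (mulfI q0).
have sE : s al * s g' = Q * s al1 by rewrite -rmorphM al1E rmorphM /= /Q rmorph_nat.
have sgg' : s g * s g' = Q * (1 + Q * s w0).
  by rewrite -rmorphM gg' !(rmorphM, rmorphD, rmorph1) /= /Q rmorph_nat.
transitivity ((1 + Q * r1) * (s al * s g') * s g).
  by transitivity ((1 + Q * r1) * s al * (s g * s g')); [rewrite sgg' | ]; ring.
rewrite sE; transitivity (Q * ((1 + Q * r1) * s al1) * s g); first by ring.
rewrite E1 mulrA -al1E; transitivity (al * (g' * s g) * be1); first by ring.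
by rewrite Ef; ring.
Qed.

(** Since n/q = (n/q) (1 + q r) - r n, the primes can be removed from [n] one at a time. *)
Lemma ideal_contains_one z q0 (J : algC -> Prop) (n : nat) :
  (forall x y, J x -> J y -> J (x + y)) ->
  (forall x y, ZZ z x -> J y -> J (x * y)) ->
  (q0 > 0)%N -> (n > 0)%N -> J n%:R ->
  (forall q, prime q -> (q %| n)%N -> exists2 r, ZZ z r & J (1 + q%:R * r)) ->
  J 1.
Proof.
move=> JD JM _; have [m] := ubnP n; elim: m n => // m IH n; rewrite ltnS => nm n0 Jn Jq.
have [n1|n_gt1] := leqP n 1; first by have -> : 1 = n%:R :> algC by have -> : n = 1%N by lia.
have qp := pdiv_prime n_gt1; set q := pdiv n in qp.
have [n' nE] := dvdnP (pdiv_dvd n); rewrite -/q in nE.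
have q1 := prime_gt1 qp.
have n'0 : (0 < n')%N by case: (n') nE => //; lia.
have [r Hr Jr] := Jq q qp (pdiv_dvd n).
apply: (IH n') => //; first by nia.
- have -> : n'%:R = n'%:R * (1 + q%:R * r) + (- r) * n%:R by rewrite nE natrM; ring.
  by apply: JD; apply: JM => //; zz.
- by move=> p pp pd; apply: Jq => //; rewrite nE dvdn_mulr.
Qed.

(* If [q^f] did not divide [N], the element [x = 1 - al^(q^f - 1)], which kills [al] mod [q],
   would be nilpotent, hence zero, mod [q], and [al] would be a unit mod [q]. *)
Lemma prime_pow_dvd_norm z q h (f : nat) (N : int) al be (tau : 'I_f -> algC) (c : 'I_f -> nat) :
  z \in Aint -> prime q -> ZZ z al -> ZZ z be ->
  (forall i, (0 < c i)%N) ->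
  (forall x, ZZ z x -> eqq z q (x ^+ h.+2) x) ->
  (forall i, eqq z q (al ^+ (c i)) (tau i)) -> (forall i, ZZ z (tau i)) ->
  N%:~R = (\prod_i tau i) * be ->
  (eqq z q (al ^+ h.+1) 1 -> ~~ (q%:Z %| N)%Z) ->
  (q%:Z %| N)%Z -> ((q ^ f)%N%:Z %| N)%Z.
Proof.
move=> zA qp Ha Hb c0 hF tF tZ NE Hu qN.
have q1 := prime_gt1 qp.
have q0 : q%:R != 0 :> algC by rewrite pnatr_eq0; lia.
set Q := q%:R in q0 *; have QZ : ZZ z Q by exact: ZZ_nat.
apply: contraT => nqf; suff /Hu : eqq z q (al ^+ h.+1) 1 by rewrite qN.
pose x := 1 - al ^+ h.+1.
have xZ : ZZ z x by rewrite /x; zz.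
have [t Ht Et] := hF al Ha.
have xa : x * al = Q * (- t) by rewrite /x mulrBl mul1r -exprSr Et; ring.
have xt i : exists2 y, ZZ z y & x * tau i = Q * y.
  have [r Hr Er] := tF i.
  exists (- t * al ^+ (c i).-1 - x * r); first zz.
  have -> : tau i = al * al ^+ (c i).-1 - Q * r by rewrite -exprS prednK // Er; ring.
  by rewrite mulrBr mulrA xa; ring.
(* Each of the [f] factors [tau i] absorbs one [x] and releases one [q]. *)
have [y Hy Ey] : exists2 y, ZZ z y & x ^+ f * \prod_i tau i = Q ^+ f * y.
  pose K n (P : algC) := exists2 y, ZZ z y & x ^+ n * P = Q ^+ n * y.
  suff : K (\sum_(i < f) 1)%N (\prod_i tau i) by rewrite sum1_card card_ord.
  rewrite /K; elim/big_rec2: _ => [|i P n _ [y Hy Ey]]; first by exists 1; [zz | rewrite !expr0].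
  have [y' Hy' Ey'] := xt i; exists (y' * y); first zz.
  rewrite !exprD !expr1; transitivity ((x * tau i) * (x ^+ P * n)); first by ring.
  by rewrite Ey Ey'; ring.
have N0 : N != 0 by apply: contraNneq nqf => ->; rewrite dvdz0.
pose v := logn q `|N|%N.
have vf : (v < f)%N.
  rewrite ltnNge; apply: contra nqf => fv; rewrite dvdzE /=.
  by rewrite pfactor_dvdn // lt0n absz_eq0.
have [N' N'q NE'] : exists2 N' : int, ~~ (q%:Z %| N')%Z & N = (q%:Z ^+ v) * N'.
  have : ((q ^ v)%N%:Z %| N)%Z by rewrite dvdzE /= pfactor_dvdn ?lt0n ?absz_eq0.
  case/dvdzP=> N' NE'; exists N'; last by rewrite NE' mulrC -natz natrX natz.
  apply/negP=> /dvdzP[m mE].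
  have : ((q ^ v.+1)%N%:Z %| N)%Z.
    by apply/dvdzP; exists m; rewrite NE' mE expnS PoszM -mulrA.
  by rewrite dvdzE /= pfactor_dvdn ?lt0n ?absz_eq0 // -/v ltnn.
have xN' : x ^+ f * N'%:~R = Q * (Q ^+ (f - v).-1 * y * be).
  apply: (@mulfI _ (Q ^+ v)); first by rewrite expf_neq0.
  transitivity (x ^+ f * N%:~R); first by rewrite NE' rmorphM rmorphXn /=; ring.
  rewrite NE [x ^+ f * _]mulrA Ey.
  have -> : Q ^+ f = Q ^+ v * (Q * Q ^+ (f - v).-1).
    by rewrite -exprS prednK ?subn_gt0 // -exprD subnKC // ltnW.
  by ring.
have [a [b abE]] : exists a b : int, a * q%:Z + b * N' = 1.
  have [a [b E]] := Bezoutz q%:Z N'; exists a, b; rewrite E.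
  have : coprime q `|N'|%N by rewrite prime_coprime.
  by rewrite /coprime /gcdz /= => /eqP ->.
have xf : exists2 r, ZZ z r & x ^+ f = Q * r.
  exists (a%:~R * x ^+ f + b%:~R * (Q ^+ (f - v).-1 * y * be)); first zz.
  transitivity (x ^+ f * (a * q%:Z + b * N')%:~R); first by rewrite abE mulr1.
  by rewrite rmorphD !rmorphM /= mulrDr [x ^+ f * (b%:~R * _)]mulrCA xN'; ring.
have [r Hr Er] := xf.
have hX n : eqq z q (x ^+ (h.+2 ^ n)) x.
  elim: n => [|n IHn]; first by rewrite expn0 expr1; exact: eqq_refl.
  by rewrite expnSr exprM; apply: eqq_trans (eqqX _ xZ IHn) (hF _ xZ).
have [s Hs Es] := hX f.
have fh : (f <= h.+2 ^ f)%N by apply: ltnW; exact: ltn_expl.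
exists (- (r * x ^+ (h.+2 ^ f - f) - s)); first zz.
have xE : x = Q * (r * x ^+ (h.+2 ^ f - f) - s).
  by rewrite mulrBr mulrA -Er -exprD subnKC // Es; ring.
have -> : al ^+ h.+1 = 1 - x by rewrite /x; ring.
by rewrite {1}xE; ring.
Qed.

(** * Cyclotomic polynomials of prime power order *)

Lemma Cyclotomic_dvd n z F : n.-primitive_root z -> ev F z = 0 ->
  exists A, F = 'Phi_n * A.
Proof.
move=> zn Fz; have mP := Cyclotomic_monic n.
have FE := Pdiv.RingMonic.rdivp_eq mP F.
set A := Pdiv.Ring.rdivp F _ in FE; set B := Pdiv.Ring.rmodp F _ in FE.
have Phi0 : ev 'Phi_n z = 0.
  by rewrite /ev (Cintr_Cyclotomic zn); apply/eqP; rewrite [_ == 0]root_cyclotomic.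
have Bz : ev B z = 0 by have := Fz; rewrite FE evD evM Phi0 mulr0 add0r.
have sB : (size B < size 'Phi_n)%N by rewrite Pdiv.Ring.ltn_rmodpN0 ?monic_neq0.
exists A; rewrite {1}FE mulrC; suff -> : B = 0 by rewrite addr0.
have [P [PE Pm] Pd] := minCpolyP z.
pose BQ := map_poly (intr : int -> rat) B.
have BQE : map_poly (ratr : rat -> algC) BQ = map_poly intr B.
  by rewrite -map_poly_comp; apply: eq_map_poly => a /=; rewrite rmorph_int.
have : root (map_poly (ratr : rat -> algC) BQ) z by rewrite BQE /root -[_.[_]]/(ev B z) Bz.
rewrite Pd => PB; apply/eqP; apply: contraTT sB => B0.
have sP : size P = (totient n).+1.
  rewrite -(size_map_poly (ratr : {rmorphism rat -> algC})) /= -PE.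
  by rewrite (minCpoly_cyclotomic zn) size_cyclotomic.
have szBQ : size BQ = size B by apply: size_map_inj_poly => //; apply: intr_inj.
rewrite -leqNgt size_Cyclotomic -sP -szBQ; apply: dvdp_leq => //.
by rewrite -size_poly_eq0 szBQ size_poly_eq0.
Qed.

Lemma ev_Cyclotomic_prim n z : n.-primitive_root z -> ev 'Phi_n z = 0.
Proof.
by move=> zn; rewrite /ev (Cintr_Cyclotomic zn); apply/eqP; rewrite [_ == 0]root_cyclotomic.
Qed.

Lemma ev_Cyclotomic n z x : n.-primitive_root z ->
  ev 'Phi_n x = \prod_(c < n | coprime c n) (x - z ^+ c).
Proof.
move=> zn; rewrite /ev (Cintr_Cyclotomic zn) /cyclotomic horner_prod.
by apply: eq_bigr => i _; rewrite hornerXsubC.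
Qed.

Lemma Cyclotomic_ppow p k : prime p ->
  'Phi_(p ^ k.+1) = \sum_(i < p) 'X^(i * p ^ k).
Proof.
move=> p_pr; set Psi := \sum_(i < p) _; have p1 := prime_gt1 p_pr.
have N0 : (0 < p ^ k.+1)%N by rewrite expn_gt0 prime_gt0.
have [z zn] := C_prim_root_exists N0.
have M : Psi * ('X^(p ^ k) - 1) = 'X^(p ^ k.+1) - 1.
  rewrite expnSr [in RHS]exprM [in RHS]subrX1 [RHS]mulrC /Psi; congr (_ * _).
  by apply: eq_bigr => i _; rewrite mulnC exprM.
have m0 : (0 < p ^ k)%N by rewrite expn_gt0 prime_gt0.
have Pm : Psi \is monic.
  by rewrite -(monicMr _ (monicXnsubC 1 m0)) M monicXnsubC.
have sP : size Psi = (totient (p ^ k.+1)).+1.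
  have := congr1 (fun P : {poly int} => size P) M.
  rewrite size_Mmonic ?monic_neq0 ?monicXnsubC // !size_XnsubC //.
  rewrite totient_pfactor //= addnS /= => sE.
  have : (p ^ k.+1 = p.-1 * p ^ k + p ^ k)%N by rewrite -mulSnr prednK ?prime_gt0 ?expnS.
  lia.
have Pz : ev Psi z = 0.
  have := congr1 (ev^~ z) M; rewrite !evE => /eqP.
  rewrite (prim_expr_order zn) subrr mulf_eq0 subr_eq0 => /orP[/eqP //|].
  rewrite -(prim_order_dvd zn) => /dvdn_leq; rewrite expn_gt0 prime_gt0 // => /(_ isT).
  by rewrite leq_exp2l // ltnn.
have [A AE] := Cyclotomic_dvd zn Pz.
have mP := Cyclotomic_monic (p ^ k.+1).
have Am : A \is monic by rewrite -(monicMl A mP) -AE.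
have : size A = 1%N.
  have := congr1 (fun P : {poly int} => size P) AE.
  rewrite mulrC size_Mmonic ?monic_neq0 // sP size_Cyclotomic addnS /=.
  lia.
move=> /eqP/size_poly1P[a a0 Aa].
by move: Am AE; rewrite Aa monicE lead_coefC => /eqP -> ->; rewrite mulr1.
Qed.

Lemma Cyclotomic_ppow_at1 p k : prime p -> ('Phi_(p ^ k.+1)).[1] = p%:Z.
Proof.
move=> p_pr; rewrite Cyclotomic_ppow // horner_sum.
rewrite (eq_bigr (fun=> 1)) => [|i _]; last by rewrite hornerXn expr1n.
by rewrite sumr_const card_ord natz.
Qed.

Lemma ev_Cyclotomic_low p k z : prime p -> z ^+ (p ^ k) = 1 ->
  ev 'Phi_(p ^ k.+1) z = p%:R.
Proof.
move=> p_pr zk; rewrite Cyclotomic_ppow // ev_sum.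
rewrite (eq_bigr (fun=> 1)) => [|i _]; last by rewrite evXn mulnC exprM zk expr1n.
by rewrite sumr_const card_ord.
Qed.

(** The derivative at 1 is p^k times the binomial coefficient (p choose 2), which an odd p divides
    even for k = 0. *)
Lemma Cyclotomic_ppow_deriv1 p k : prime p -> (2 < p)%N ->
  (p%:Z %| ('Phi_(p ^ k.+1))^`().[1])%Z.
Proof.
move=> p_pr p2; rewrite Cyclotomic_ppow // raddf_sum horner_sum /=.
rewrite (eq_bigr (fun i : 'I_p => (i * p ^ k)%N%:Z)) => [|i _]; last first.
  by rewrite derivXn hornerMn hornerXn expr1n natz.
have -> : \sum_(i < p) (i * p ^ k)%N%:Z = (\sum_(i < p) i * p ^ k)%N%:Z.
  by rewrite -[RHS]natz natr_sum; apply: eq_bigr => i _; rewrite natz.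
rewrite -big_distrl /= -(big_mkord xpredT (fun i => i)) bin2_sum dvdzE /=.
by rewrite dvdn_mulr // prime_dvd_bin.
Qed.

(** ['Phi_(p ^ k.+1)] and its derivative both vanish at 1 modulo p, so F'(1) mod p depends only on
    the value F(z). It serves to show that 1 - z does not divide a value twice. *)
Lemma deriv1_dvd p k z F A : prime p -> (2 < p)%N ->
  (p ^ k.+1).-primitive_root z ->
  ev F z = (1 - z) ^+ 2 * ev A z -> (p%:Z %| F^`().[1])%Z.
Proof.
move=> p_pr p2 zn E.
have [|B BE] := Cyclotomic_dvd (F := F - (1 - 'X) ^+ 2 * A) zn.
  by rewrite !evE E subrr.
move/(canRL (subrK _)): BE => ->.
rewrite expr2 derivD !derivM !hornerE Cyclotomic_ppow_at1 //=.
by rewrite !addr0 rpredD // ?dvdz_mulr // Cyclotomic_ppow_deriv1.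
Qed.

Lemma prim_root_aut n z c : n.-primitive_root z -> coprime c n ->
  exists u : {rmorphism algC -> algC}, forall F, u (ev F z) = ev F (z ^+ c).
Proof.
move=> zn cn; have [u Hu] := Qn_aut_exists cn; exists u => F.
by rewrite ev_rmorph Hu // (prim_expr_order zn).
Qed.

Lemma prim_root_conj n (z : algC) : n.-primitive_root z -> z^* = z ^+ n.-1.
Proof.
move=> zn; have n0 := prim_order_gt0 zn.
have zN : z ^+ n = 1 := prim_expr_order zn.
have z0 : z != 0 by rewrite (prim_root_eq0 zn); lia.
apply: (mulfI z0); rewrite -exprS prednK // zN -normCK.
have /eqP -> : `|z| == 1 by rewrite -(@pexpr_eq1 _ _ n) // -normrX zN normr1.
by rewrite expr1n.
Qed.

Lemma prim_root_mul_conj n (z : algC) a : n.-primitive_root z ->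
  z ^+ a * (z ^+ a)^* = 1.
Proof.
move=> zn; rewrite rmorphXn /= -exprMn (prim_root_conj zn) -exprS.
by rewrite prednK ?(prim_order_gt0 zn) // (prim_expr_order zn) expr1n.
Qed.

(** * Circulant determinants as products of norms *)

(** The columns of the Vandermonde matrix of the n-th roots of unity are eigenvectors common to all
    circulants. *)
Lemma det_circulant n (w : algC) (a : nat -> int) : n.-primitive_root w ->
  (\det (circulant n a))%:~R = \prod_(i < n) ev (\poly_(j < n) a j) (w ^+ i).
Proof.
move=> wn; have n0 := prim_order_gt0 wn.
pose lam := \row_(i < n) ev (\poly_(j < n) a j) (w ^+ i).
pose V := Vandermonde n (\row_(i < n) w ^+ i).
have CV : map_mx intr (circulant n a) *m V = V *m diag_mx lam.
  apply/matrixP=> r i; rewrite mul_mx_diag !mxE.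
  set x := w ^+ i; have xn : x ^+ n = 1 by rewrite /x exprAC (prim_expr_order wn) expr1n.
  pose h (j : 'I_n) := Ordinal (ltn_pmod (j + r) n0).
  have hE (j : 'I_n) : ((h j + n - r) %% n)%N = j.
    have jn := ltn_ord j; have rn := ltn_ord r; rewrite /h /=.
    case: (ltnP (j + r) n) => H.
      by rewrite (modn_small H) (_ : j + r + n - r = j + n)%N ?modnDr ?modn_small //; lia.
    rewrite (_ : (j + r) %% n = j + r - n)%N; last first.
      by rewrite -{1}(subnK H) modnDr modn_small //; lia.
    by rewrite (_ : j + r - n + n - r = j)%N ?modn_small //; lia.
  have hI : injective h by move=> j j' E; apply: val_inj; rewrite /= -(hE j) E hE.
  rewrite (reindex_inj hI) /= /ev.
  have -> : map_poly intr (\poly_(j < n) a j) = \poly_(j < n) (a j)%:~R :> {poly algC}.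
    by apply/polyP=> j; rewrite coef_map !coef_poly; case: ifP.
  rewrite horner_poly mulr_sumr; apply: eq_bigr => j _.
  by rewrite !mxE (hE j) expr_mod // exprD /x; ring.
have V0 : \det V != 0.
  rewrite det_Vandermonde; apply/prodf_neq0 => i _; apply/prodf_neq0 => j ij.
  by rewrite !mxE subr_eq0 (eq_prim_root_expr wn) !modn_small // neq_ltn ij orbT.
rewrite -det_map_mx; apply: (mulIf V0); rewrite -det_mulmx CV det_mulmx mulrC det_diag.
by congr (_ * _); apply: eq_bigr => i _; rewrite mxE.
Qed.

(** Reduction of [F] modulo X^n - 1 turns the product into a circulant determinant; integrality
    needs no Galois theory. *)
Lemma prod_unity_int n (w : algC) F : n.-primitive_root w ->
  exists d : int, d%:~R = \prod_(i < n) ev F (w ^+ i).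
Proof.
move=> wn; have n0 := prim_order_gt0 wn.
have mX : ('X^n - 1 : {poly int}) \is monic by apply: monicXnsubC.
pose B := Pdiv.Ring.rmodp F ('X^n - 1).
have sB : (size B <= n)%N.
  have := Pdiv.Ring.ltn_rmodpN0 F (monic_neq0 mX).
  by rewrite size_XnsubC.
have BE : \poly_(j < n) B`_j = B.
  apply/polyP=> i; rewrite coef_poly; case: ltnP => // H.
  by rewrite nth_default // (leq_trans sB).
exists (\det (circulant n (fun j => B`_j))); rewrite (det_circulant _ wn) BE.
apply: eq_bigr => i _.
rewrite [F in RHS](Pdiv.RingMonic.rdivp_eq mX) evD evM evB evXn ev1.
by rewrite exprAC (prim_expr_order wn) expr1n subrr mulr0 add0r.
Qed.

(* The norm of [F z] from [Q(z)] to [Q], for [z] of order [n]. *)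
Definition nrm (F : {poly int}) (z : algC) (n : nat) :=
  \prod_(c < n | coprime c n) ev F (z ^+ c).

Lemma prod_split_coprime p k (z : algC) (f : algC -> algC) : prime p ->
  \prod_(i < p ^ k.+1) f (z ^+ i) =
  (\prod_(c < p ^ k.+1 | coprime c (p ^ k.+1)) f (z ^+ c)) *
  \prod_(i < p ^ k) f ((z ^+ p) ^+ i).
Proof.
move=> p_pr; have p0 := prime_gt0 p_pr.
rewrite (bigID (fun i : 'I__ => coprime i (p ^ k.+1))) /=; congr (_ * _).
have hP (i : 'I_(p ^ k)) : (p * i < p ^ k.+1)%N by rewrite expnS ltn_pmul2l.
have h'P (i : 'I_(p ^ k.+1)) : (i %/ p < p ^ k)%N.
  by rewrite ltn_divLR // -expnSr.
rewrite (reindex_onto (fun i => Ordinal (hP i)) (fun i => Ordinal (h'P i))) /=.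
  apply: eq_big => [i|i _]; last by rewrite exprM.
  rewrite coprime_pexpr // coprime_sym prime_coprime // dvdn_mulr //=.
  by apply/eqP/val_inj; rewrite /= mulKn.
move=> i; rewrite coprime_pexpr // coprime_sym prime_coprime // negbK => pi.
by apply: val_inj; rewrite /= mulnC divnK.
Qed.

Lemma prim_root_pow_p p k (z : algC) : prime p -> (p ^ k.+1).-primitive_root z ->
  (p ^ k).-primitive_root (z ^+ p).
Proof.
move=> p_pr zn; have p0 := prime_gt0 p_pr.
have := dvdn_prim_root zn (_ : p ^ k %| p ^ k.+1)%N.
by rewrite expnS mulnK ?expn_gt0 ?p0 //; apply; rewrite dvdn_mull.
Qed.

(** The norm is a quotient of the full products at two consecutive levels, hence rational, and it is
    an algebraic integer; a nonzero product allows the division. *)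
Lemma nrm_int p k (z : algC) F : prime p -> (p ^ k.+1).-primitive_root z ->
  \prod_(i < p ^ k.+1) ev F (z ^+ i) != 0 ->
  exists N : int, N%:~R = nrm F z (p ^ k.+1).
Proof.
move=> p_pr zn.
have zpn := prim_root_pow_p p_pr zn.
have [d dE] := prod_unity_int F zn; have [d' d'E] := prod_unity_int F zpn.
rewrite prod_split_coprime // -/(nrm F z _) mulf_eq0 negb_or -d'E => /andP[_ d'0].
have E : d%:~R = nrm F z (p ^ k.+1) * d'%:~R by rewrite dE d'E prod_split_coprime.
have NE : nrm F z (p ^ k.+1) = d%:~R / d'%:~R by rewrite E mulfK.
have /intrP[N ->] : nrm F z (p ^ k.+1) \in Num.int; last by exists N.
apply: Cint_rat_Aint; first by rewrite NE rpred_div // rpred_int.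
apply: (@ZZ_Aint z); first exact: Aint_prim_root zn.
by apply: ZZ_prod => c _; exists (F \Po 'X^c); rewrite !evE.
Qed.

Lemma prod_unity_norms p t (w : algC) F : prime p -> (p ^ t).-primitive_root w ->
  \prod_(i < p ^ t) ev F (w ^+ i) != 0 ->
  exists N : nat -> int,
    (forall k, (0 < k <= t)%N -> (N k)%:~R = nrm F (w ^+ (p ^ (t - k))) (p ^ k)) /\
    \prod_(i < p ^ t) ev F (w ^+ i) = (F.[1] * \prod_(1 <= k < t.+1) N k)%:~R.
Proof.
move=> p_pr; elim: t w => [|t IH] w wn M0.
  exists (fun=> 0); split => [k|]; first by case: k.
  by rewrite expn0 big_ord1 expr0 ev_at1 big_nil mulr1.
have [N NE] := nrm_int p_pr wn M0.
have zpn := prim_root_pow_p p_pr wn.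
move: M0; rewrite prod_split_coprime // -/(nrm F w _) mulf_eq0 negb_or => /andP[_ M0].
have [N' [H' E']] := IH _ zpn M0.
exists (fun k => if k == t.+1 then N else N' k); split=> [k /andP[k0 kt]|].
  case: eqP => [->|/eqP kt']; first by rewrite subnn expn0 expr1.
  rewrite H'; last by rewrite k0 -ltnS ltn_neqAle kt'.
  by rewrite -exprM -expnS subSn // -ltnS ltn_neqAle kt'.
rewrite E' -NE [in RHS]big_nat_recr //= eqxx -rmorphM mulrC -mulrA; congr (_ * (_ * _))%:~R.
by apply: eq_big_nat => i /andP[_ it]; rewrite ltn_eqF.
Qed.

(** * Units of absolute value one *)

Lemma parseval n (w : algC) (P : {poly int}) : n.-primitive_root w -> (size P <= n)%N ->
  \sum_(a < n) ev P (w ^+ a) * (ev P (w ^+ a))^* = (n%:Z * \sum_(i < n) P`_i ^+ 2)%:~R.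
Proof.
move=> wn sP; have n0 := prim_order_gt0 wn.
have wN := prim_expr_order wn.
have PE x : ev P x = \sum_(i < n) (P`_i)%:~R * x ^+ i.
  rewrite /ev (@horner_coef_wide _ n).
    by apply: eq_bigr => i _; rewrite coef_map.
  by rewrite (leq_trans (size_poly _ _)).
have step a : ev P (w ^+ a) * (ev P (w ^+ a))^* =
    \sum_(i < n) \sum_(j < n) (P`_i)%:~R * (P`_j)%:~R * (w ^+ i * (w ^+ j)^*) ^+ a.
  rewrite !PE rmorph_sum mulr_suml; apply: eq_bigr => i _.
  rewrite mulr_sumr; apply: eq_bigr => j _.
  rewrite rmorphM /= rmorph_int !rmorphXn /= exprMn -!exprM.
  by rewrite [(a * i)%N]mulnC [(a * j)%N]mulnC; ring.
rewrite (eq_bigr _ (fun (a : 'I_n) _ => step a)) exchange_big /= rmorphM rmorph_sum mulr_sumr.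
apply: eq_bigr => i _; rewrite exchange_big (bigD1 i) //= [X in _ + X]big1 => [|j ji].
  have wi := prim_root_mul_conj i wn.
  rewrite addr0 wi rmorphXn /= (eq_bigr (fun=> (P`_i)%:~R ^+ 2)) => [|a _].
    by rewrite sumr_const card_ord -mulr_natl.
  by rewrite expr1n mulr1.
rewrite -mulr_sumr; set y := w ^+ i * _.
have wj := prim_root_mul_conj j wn.
have y1 : y - 1 != 0.
  rewrite subr_eq0; apply: contraNneq ji => yE.
  have : w ^+ i == w ^+ j by rewrite -[w ^+ i]mulr1 -wj [w ^+ j * _]mulrC mulrA -/y yE mul1r.
  by rewrite (eq_prim_root_expr wn) !modn_small // => /eqP E; apply/eqP/val_inj.
have yn : y ^+ n = 1.
  by rewrite /y exprMn -rmorphXn /= !(exprAC w _ n) wN !expr1n rmorph1 mulr1.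
have : (y - 1) * \sum_(a < n) y ^+ a = 0 by rewrite -subrX1 yn subrr.
by move/eqP; rewrite mulf_eq0 (negPf y1) => /eqP ->; rewrite mulr0.
Qed.

Lemma int_sq_le2 (x : int) : x ^+ 2 <= 2 -> x != 0 -> x = 1 \/ x = -1.
Proof.
rewrite expr2 => H x0; have : -2 < x by rewrite ltNge; apply/negP => ?; nia.
have : x < 2 by rewrite ltNge; apply/negP => ?; nia.
by lia.
Qed.

Lemma sum_sq2 n (D : 'I_n -> int) : \sum_i D i ^+ 2 = 2 -> \sum_i D i = 0 ->
  exists i1 i2, [/\ i1 != i2, D i1 = 1, D i2 = -1 &
    forall i, i != i1 -> i != i2 -> D i = 0].
Proof.
move=> S2 S0.
have [/existsP[i Di]|/existsPn H] := boolP [exists i, D i != 0]; last first.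
  move: S2; rewrite big1 => [//|i _]; move: (H i); rewrite negbK => /eqP ->.
  by rewrite expr0n.
move: S2 S0; rewrite (bigD1 i) //= [\sum_j D j](bigD1 i) //=.
set R := \sum_(_ < _ | _) _; move=> S2 S0.
have R0 : 0 <= R by apply: sumr_ge0 => j _; apply: sqr_ge0.
have [/existsP[j /andP[ji Dj]]|/existsPn H] := boolP [exists j, (j != i) && (D j != 0)]; last first.
  have R00 : R = 0.
    rewrite /R big1 // => j ji; move: (H j); rewrite ji /= negbK => /eqP ->.
    by rewrite expr0n.
  have Dsq : D i ^+ 2 <= 2 by rewrite -S2 R00 addr0.
  by have [] := int_sq_le2 Dsq Di => D1; move: S2; rewrite R00 D1.
move: S2 S0 R0; rewrite /R (bigD1 j) //= [\sum_(_ < _ | _) D _](bigD1 j) //=.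
set R' := \sum_(_ < _ | _) D _ ^+ 2; move=> S2 S0 _.
have R'0 : 0 <= R' by apply: sumr_ge0 => l _; apply: sqr_ge0.
have Di2 : D i = 1 \/ D i = -1.
  by apply: int_sq_le2 => //; rewrite -S2 lerDl addr_ge0 ?sqr_ge0.
have Dj2 : D j = 1 \/ D j = -1.
  by apply: int_sq_le2 => //; rewrite -S2 addrCA lerDl addr_ge0 ?sqr_ge0.
have R'00 : R' = 0 by case: Di2 Dj2 S2 => -> [] ->; rewrite !expr2; lia.
have Z l : l != i -> l != j -> D l = 0.
  move=> li lj; move/eqP: R'00; rewrite psumr_eq0 => [/allP/(_ l)|m _]; last exact: sqr_ge0.
  by rewrite mem_index_enum li lj sqrf_eq0 => /(_ isT)/eqP.
move: S0; rewrite big1 ?addr0 => [S0|l /andP[li lj]]; last exact: Z.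
have [D1|D1] := Di2.
  by exists i, j; split=> //; [rewrite eq_sym | lia].
exists j, i; split=> //; [lia | by move=> l lj li; apply: Z].
Qed.

(* By Parseval over the [p^(k+1)]-th roots of unity, the coefficients of [(1 - z^(p^k)) u], reduced
   mod [X^(p^(k+1)) - 1], have the same sum of squares, 2, as those of [1 - X^(p^k)]; so this product
   is a difference of two powers of [z]. *)
Lemma unit_circle_cyclotomic p k (z u : algC) : prime p -> (p ^ k.+1).-primitive_root z ->
  ZZ z u -> u * u^* = 1 -> exists s, u = z ^+ s \/ u = - z ^+ s.
Proof.
move=> p_pr zn [U UE] uu; set n := (p ^ k.+1)%N in zn; pose m := (p ^ k)%N.
have n0 : (0 < n)%N := prim_order_gt0 zn.
have nE : n = (p * m)%N by rewrite /n expnS.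
have mn : (m < n)%N by rewrite /n /m ltn_exp2l ?prime_gt1.
have zN := prim_expr_order zn.
have m0 : (0 < m)%N by rewrite expn_gt0 prime_gt0.
have mX : ('X^n - 1 : {poly int}) \is monic by apply: monicXnsubC.
pose P0 : {poly int} := 1 - 'X^m.
pose B := Pdiv.Ring.rmodp (P0 * U) ('X^n - 1).
have sB : (size B <= n)%N.
  by have := Pdiv.Ring.ltn_rmodpN0 (P0 * U) (monic_neq0 mX); rewrite size_XnsubC.
have sP0 : (size P0 <= n)%N by rewrite /P0 -opprB size_polyN size_XnsubC.
have BE x : x ^+ n = 1 -> ev B x = (1 - x ^+ m) * ev U x.
  move=> xn; have := congr1 (ev^~ x) (Pdiv.RingMonic.rdivp_eq mX (P0 * U)).
  by rewrite -/B !evE xn subrr mulr0 add0r => <-.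
(* Galois conjugation carries |u| = 1 to z^a only for [a] prime to p. At the other roots nothing is
   known of [U], but there the factor 1 - X^(p^k) vanishes; this is why it was introduced. *)
have absE a : ev B (z ^+ a) * (ev B (z ^+ a))^* = ev P0 (z ^+ a) * (ev P0 (z ^+ a))^*.
  have xn : (z ^+ a) ^+ n = 1 by rewrite exprAC zN expr1n.
  rewrite BE // /P0 !evE rmorphM mulrACA.
  have [pa|pa] := boolP (p %| a)%N.
    have -> : (z ^+ a) ^+ m = 1.
      by case/dvdnP: pa => b ->; rewrite -exprM -mulnA -nE mulnC exprM zN expr1n.
    by rewrite subrr !mul0r.
  have ca : coprime a n by rewrite coprime_pexpr // coprime_sym prime_coprime.
  have [t tE] := prim_root_aut zn ca.
  suff -> : ev U (z ^+ a) * (ev U (z ^+ a))^* = 1 by rewrite mulr1.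
  have uu' : ev (U * (U \Po 'X^(n.-1))) z = 1.
    by rewrite !evE -(prim_root_conj zn) -ev_rmorph -UE.
  have := congr1 t uu'; rewrite tE rmorph1 => <-.
  by rewrite !evE ev_rmorph rmorphXn /= (prim_root_conj zn) exprAC.
have : (n%:Z * \sum_(i < n) B`_i ^+ 2)%:~R = (n%:Z * \sum_(i < n) P0`_i ^+ 2)%:~R :> algC.
  by rewrite -!(parseval zn) //; apply: eq_bigr => a _.
move/intr_inj; have nZ : n%:Z != 0 by rewrite -lt0n.
move/(mulfI nZ).
have -> : \sum_(i < n) P0`_i ^+ 2 = 2.
  rewrite (bigD1 (Ordinal n0)) //= (bigD1 (Ordinal mn)) /=; last by rewrite -val_eqE /= -lt0n.
  rewrite big1 => [|i /andP[]]; rewrite -?val_eqE /P0 /= !coefB !coef1 !coefXn ?eqxx.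
    by rewrite [m == 0]eqn0Ngt [0 == m]eq_sym eqn0Ngt m0.
  by move=> /negPf -> /negPf ->.
move=> S2; have S0 : \sum_(i < n) B`_i = 0.
  apply: (@intr_inj algC); have := BE 1 (expr1n _ _); rewrite expr1n subrr mul0r.
  rewrite /ev (@horner_coef_wide _ n); last by rewrite (leq_trans (size_poly _ _)).
  move=> H; rewrite -[RHS]/(0 : algC) -H rmorph_sum; apply: eq_bigr => i _.
  by rewrite coef_map expr1n mulr1.
have [i1 [i2 [i12 B1 B2 B0]]] := sum_sq2 S2 S0.
have Bz : ev B z = z ^+ i1 - z ^+ i2.
  rewrite /ev (@horner_coef_wide _ n); last by rewrite (leq_trans (size_poly _ _)).
  rewrite (bigD1 i1) //= (bigD1 i2) /=; last by rewrite eq_sym.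
  rewrite big1 => [|i /andP[h1 h2]]; last by rewrite coef_map /= B0 // mul0r.
  by rewrite !coef_map /= B1 B2 addr0 mul1r mulN1r.
set x := z ^+ i1 in Bz; set y := z ^+ i2 in Bz; pose e := z ^+ m.
have conjX a : z ^+ a * (z ^+ a)^* = 1 by exact: prim_root_mul_conj zn.
have E1 : (1 - e) * u = x - y by rewrite -Bz BE // UE.
have e1 : 1 - e != 0.
  rewrite subr_eq0 eq_sym -(prim_order_dvd zn) gtnNdvd //.
have E2 : (1 - e) * (1 - e^*) = (x - y) * (x^* - y^*).
  have -> : 1 - e^* = (1 - e)^* by rewrite rmorphB rmorph1.
  have -> : x^* - y^* = (x - y)^* by rewrite rmorphB.
  by rewrite -E1 rmorphM mulrACA uu mulr1.
have xx : x * x^* = 1 by exact: conjX.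
have yy : y * y^* = 1 by exact: conjX.
have ee : e * e^* = 1 by exact: conjX.
(* The chords from 1 to [e] and from [x] to [y] of the unit circle have equal length, so y/x is [e]
   or its conjugate. *)
have : (y * x^* - e) * (1 - (y^* * x) * e^*) = 0.
  have -> : (y * x^* - e) * (1 - (y^* * x) * e^*) =
    y * x^* - e + (e * e^*) * (y^* * x) - (x * x^*) * (y * y^*) * e^* by ring.
  rewrite ee xx yy; move: E2.
  have -> : (1 - e) * (1 - e^*) = 1 - e - e^* + e * e^* by ring.
  have -> : (x - y) * (x^* - y^*) = x * x^* + y * y^* - y * x^* - y^* * x by ring.
  rewrite ee xx yy => E3.
  transitivity ((1 - e - e^* + 1) - (1 + 1 - y * x^* - y^* * x)); first by ring.
  by rewrite E3 subrr.
move/eqP; rewrite mulf_eq0 => /orP[/eqP H|/eqP H].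
- exists i1; left; apply: (mulfI e1); rewrite E1 -/x.
  have -> : y = x * e.
    rewrite -(subr0_eq H); transitivity ((x * x^*) * y); last by ring.
    by rewrite xx mul1r.
  by ring.
- exists (i1 + m * n.-1)%N; right; apply: (mulfI e1); rewrite E1.
  have -> : z ^+ (i1 + m * n.-1) = x * e^*.
    by rewrite exprD /e rmorphXn /= (prim_root_conj zn) -!exprM [(n.-1 * m)%N]mulnC.
  have -> : y = x * e^*.
    transitivity (y * (y^* * x * e^*)); last first.
      by transitivity ((y * y^*) * (x * e^*)); [ring | rewrite yy mul1r].
    by rewrite -[LHS]mulr1; congr (_ * _); rewrite (subr0_eq H).
  by transitivity (x * (e * e^*) - x * e^*); [rewrite ee mulr1 | ring].
Qed.

(** * The dichotomy at one level *)

Lemma taylor1 (F : {poly int}) :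
  exists2 G, F = F.[1]%:P + G * ('X - 1) & G.[1] = F^`().[1].
Proof.
have : root (F - F.[1]%:P) 1 by rewrite /root !hornerE subrr.
case/factor_theorem=> G GE; exists G; first by rewrite -polyC1 -GE addrC subrK.
have -> : F = F.[1]%:P + G * ('X - 1%:P) by rewrite -GE addrC subrK.
by rewrite derivD derivC derivM !derivE !hornerE.
Qed.

(** Expanding ['Phi_(p ^ k.+1)] at 1 writes p as (1 - z) P1(z), which absorbs the constant term
    F(1). This alters the cofactor's value at 1, initially F'(1), by a multiple of P1(1), divisible
    by p. When p | F'(1) the lemma applies again to [A]. *)
Lemma factor_at_p p k (z : algC) F : prime p -> (2 < p)%N -> (p ^ k.+1).-primitive_root z ->
  (p%:Z %| F.[1])%Z ->
  exists2 A, ev F z = (z - 1) * ev A z & (p%:Z %| A.[1])%Z = (p%:Z %| F^`().[1])%Z.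
Proof.
move=> p_pr p2 zn /dvdzP[b bE].
have [F1 FE F1E] := taylor1 F; have [P1 PE P1E] := taylor1 'Phi_(p ^ k.+1).
exists (F1 - b%:P * P1).
  have := ev_Cyclotomic_prim zn; rewrite PE Cyclotomic_ppow_at1 // !evE => /eqP.
  rewrite addr_eq0 => /eqP pE.
  by rewrite FE bE !evE rmorphM /= pE; ring.
rewrite !hornerE F1E P1E rpredBr //.
by apply: dvdz_mull; apply: Cyclotomic_ppow_deriv1.
Qed.

Lemma mult_order q n : (1 < n)%N -> coprime q n ->
  exists f, [/\ (0 < f)%N, (q ^ f = 1 %[mod n])%N &
    forall i, (0 < i < f)%N -> (q ^ i <> 1 %[mod n])%N].
Proof.
move=> n1 qn.
have ex : exists f, (0 < f)%N && (q ^ f == 1 %[mod n])%N.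
  exists (totient n); rewrite totient_gt0 (ltnW n1) /=.
  by apply/eqP; apply: Euler_exp_totient.
case: (ex_minnP ex) => f /andP[f0 /eqP fE] fmin; exists f; split=> // i /andP[i0 fi] iE.
by have := fmin i; rewrite i0 iE eqxx leqNgt fi => /(_ isT).
Qed.

Section Dichotomy.
Variables (p k : nat) (z : algC) (F : {poly int}) (N : int).
Hypotheses (p_pr : prime p) (p2 : (2 < p)%N) (zn : (p ^ k.+1).-primitive_root z).
Hypotheses (NE : N%:~R = nrm F z (p ^ k.+1)) (N0 : N != 0).
Let n := (p ^ k.+1)%N.

Let n1 : (1 < n)%N.
Proof. by rewrite -(expn0 p) ltn_exp2l ?prime_gt1. Qed.
Let zN : z ^+ n = 1. Proof. exact: prim_expr_order zn. Qed.
Let zA : z \in Aint. Proof. exact: Aint_prim_root zn. Qed.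

Lemma ZZ_evX c : ZZ z (ev F (z ^+ c)).
Proof. by exists (F \Po 'X^c); rewrite !evE. Qed.

Lemma frobenius_period q f x : prime q -> (q ^ f = 1 %[mod n])%N -> ZZ z x ->
  eqq z q (x ^+ (q ^ f)) x.
Proof.
move=> q_pr fE [G ->]; have := frobenius_iter z G f q_pr.
have -> : z ^+ (q ^ f) = z by rewrite -(expr_mod _ zN) fE (expr_mod _ zN).
by [].
Qed.

Lemma nrm_unit_mod q h : prime q ->
  eqq z q (ev F z ^+ h.+1) 1 -> ~~ (q%:Z %| N)%Z.
Proof.
move=> q_pr [r [R ->] E]; apply/negP=> qN.
have H : eqq z q ((N ^+ h.+1)%:~R) 1%:~R.
  rewrite rmorphXn /= NE /nrm -prodrXl.
  rewrite (_ : 1%:~R = \prod_(c < p ^ k.+1 | coprime c (p ^ k.+1)) (1 : algC)); last by rewrite big1.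
  apply: eqq_prod => [i _|c cn]; first exact: ZZ1.
  have [t tE] := prim_root_aut zn cn.
  exists (ev R (z ^+ c)); first by exists (R \Po 'X^c); rewrite !evE.
  by rewrite -!tE -rmorphXn /= E rmorphD rmorphM rmorph1 rmorph_nat.
have := eqq_int zA (_ : q != 0%N) H; rewrite -lt0n prime_gt0 // => /(_ isT).
rewrite eqz_mod_dvd => H'.
have : N * N ^+ h - (N ^+ h.+1 - 1) \in dvdz q by rewrite rpredB // dvdz_mulr.
rewrite (_ : _ - _ = 1); last by rewrite exprS; ring.
by rewrite dvdzE /= dvdn1 => /eqP q1; rewrite q1 in q_pr.
Qed.

(** The conjugates under the [f] powers of Frobenius at [q] are distinct factors of the norm, each
    congruent modulo [q] to a power of F(z), so each contributes a factor [q]. *)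
Lemma nrm_dvd_order q f : prime q -> q != p -> (0 < f)%N -> (q ^ f = 1 %[mod n])%N ->
  (forall i, (0 < i < f)%N -> (q ^ i <> 1 %[mod n])%N) ->
  (q%:Z %| N)%Z -> ((q ^ f)%N%:Z %| N)%Z.
Proof.
move=> q_pr qp f0 fE fmin qN.
have q1 := prime_gt1 q_pr.
have qn : coprime q n.
  by rewrite coprime_pexpr // prime_coprime // dvdn_prime2.
have [h hE] : exists h, (q ^ f = h.+2)%N.
  exists (q ^ f).-2; have : (q ^ 1 <= q ^ f)%N by rewrite leq_exp2l.
  by rewrite expn1; lia.
have n0 := ltnW n1.
pose g (i : 'I_f) : 'I_n := Ordinal (ltn_pmod (q ^ i) n0).
have gI : injective g.
  suff W (i j : 'I_f) : (i < j)%N -> g i <> g j.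
    by move=> i j E; apply: val_inj; case: (ltngtP i j) => // /W; rewrite E.
  move=> ij E0; have E : (q ^ i %% n = q ^ j %% n)%N := congr1 val E0;  apply: (fmin (j - i)%N).
    by rewrite subn_gt0 ij (leq_ltn_trans (leq_subr _ _)).
  apply/eqP; rewrite eqn_mod_dvd ?expn_gt0 ?(ltnW q1) //.
  have : (n %| q ^ j - q ^ i)%N.
    by rewrite -eqn_mod_dvd ?leq_exp2l ?(ltnW ij) //; apply/eqP.
  rewrite -{1}(subnKC (ltnW ij)) expnD -[X in (_ * _ - X)%N]muln1 -mulnBr.
  by rewrite Gauss_dvdr // coprimeXr // coprime_sym.
pose Bs := [set g i | i : 'I_f].
have NB : N%:~R = (\prod_(i < f) ev F (z ^+ (q ^ i))) *
    \prod_(c < n | coprime c n && (c \notin Bs)) ev F (z ^+ c).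
  rewrite NE /nrm (bigID (mem Bs)) /=; congr (_ * _).
  rewrite (eq_bigl (mem Bs)) => [|c].
    rewrite big_imset /=; last by move=> i j _ _; apply: gI.
    by apply: eq_bigr => i _; rewrite (expr_mod _ zN).
  rewrite /= andb_idl // => /imsetP[i _ ->] /=.
  by rewrite coprime_modl coprimeXl.
apply: (@prime_pow_dvd_norm z q h f N (ev F z) _ (fun i => ev F (z ^+ (q ^ i)))
  (fun i => q ^ i)%N _ _ _ _ _ _ _ _ NB) => //.
- exact: ZZ_ev.
- by apply: ZZ_prod => c _; apply: ZZ_evX.
- by move=> i; rewrite expn_gt0 ltnW.
- by move=> x Hx; rewrite -hE; apply: frobenius_period.
- by move=> i; apply: frobenius_iter.
- by move=> i; apply: ZZ_evX.
- exact: nrm_unit_mod.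
Qed.

(** If the order is 2c, then since p is odd its whole power divides one of q^c - 1 and q^c + 1, and
    minimality excludes the first. So q^c = -1, and conjugation is the c-th power of Frobenius
    modulo [q]. *)
Lemma odd_order_or_conj q : prime q -> q != p -> (q%:Z %| N)%Z ->
  (exists2 a, odd a & (q ^ a = 1 %[mod n])%N /\ ((q ^ a)%N%:Z %| N)%Z) \/
  (exists2 c, (0 < c)%N & (n %| q ^ c + 1)%N).
Proof.
move=> q_pr qp qN; have q1 := prime_gt1 q_pr.
have qn : coprime q n by rewrite coprime_pexpr // prime_coprime // dvdn_prime2.
have [f [f0 fE fmin]] := mult_order n1 qn.
have [fo|fe] := boolP (odd f).
  by left; exists f => //; split=> //; apply: nrm_dvd_order.
right; exists f./2; first by rewrite half_gt0; case: (f) f0 fe => [|[]].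
set c := f./2; have fc : f = (c + c)%N by rewrite addnn -[LHS]odd_double_half (negPf fe).
have c0 : (0 < c)%N by lia.
have H : (n %| (q ^ c - 1) * (q ^ c + 1))%N.
  rewrite -[X in (_ %| X)%N](_ : q ^ f - 1 = _)%N.
    by rewrite -eqn_mod_dvd ?expn_gt0 ?(ltnW q1) //; apply/eqP.
  by rewrite fc expnD -[X in (_ - X)%N](exp1n 2) mulnn subn_sqr // exp1n.
have qc0 : (0 < q ^ c)%N by rewrite expn_gt0 ltnW.
have [pd|pd] := boolP (p %| q ^ c - 1)%N.
  have pd' : coprime n (q ^ c + 1).
    rewrite /n coprime_pexpl // prime_coprime //; apply/negP => pd'.
    have : (p %| (q ^ c + 1) - (q ^ c - 1))%N by rewrite dvdn_sub.
    have -> : ((q ^ c + 1) - (q ^ c - 1) = 2)%N by move: qc0; clear; move: (q ^ c)%N => x; lia.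
    by move/dvdn_leq => /(_ isT); rewrite leqNgt p2.
  move: H; rewrite Gauss_dvdl // => H; case: (fmin c); first by lia.
  by apply/eqP; rewrite eqn_mod_dvd.
by rewrite -(@Gauss_dvdr _ (q ^ c - 1)%N) // /n coprime_pexpl // prime_coprime.
Qed.

Hypothesis (pF : (p%:Z %| F.[1])%Z) (pF' : ~~ (p%:Z %| F^`().[1])%Z).

Let al := ev F z.
(** The colon ideal of (al) by its conjugate: it contains 1 exactly when [al] divides its conjugate
    in Z[z]. *)
Let J x := ZZ z x /\ exists2 b, ZZ z b & x * al^* = al * b.

Lemma ZZ_conj x : ZZ z x -> ZZ z x^*.
Proof.
move=> [G ->]; exists (G \Po 'X^(n.-1)).
by rewrite (ev_rmorph Num.conj) /= (prim_root_conj zn) !evE.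
Qed.

Lemma norm_cofactor : exists2 al', ZZ z al' & N%:~R = al * al'.
Proof.
exists (\prod_(c < n | coprime c n && (c != Ordinal n1)) ev F (z ^+ c)).
  by apply: ZZ_prod => c _; apply: ZZ_evX.
by rewrite NE /nrm (bigD1 (Ordinal n1)) /= ?coprime1n // expr1.
Qed.

Lemma bezout_one q (m : int) : prime q -> ~~ (q%:Z %| m)%Z -> exists y e : int, y * m = 1 + q%:Z * e.
Proof.
move=> q_pr qm; have [a [b E]] := Bezoutz q%:Z m; exists b, (- a).
have : coprime q `|m|%N by rewrite prime_coprime.
rewrite /coprime => /eqP C; move: E; rewrite /gcdz /= C => E.
by rewrite -[RHS]/(1%:Z + _) -E; ring.
Qed.

(** The ideal (z - 1) is stable under conjugation, so the cofactor A(z) of z - 1 in [al] lies in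
    [J]. Its p^(k+1)-th power is A(1) modulo p, and A(1) is prime to p because F'(1) is. *)
Lemma J_at_p : exists2 r, ZZ z r & J (1 + p%:R * r).
Proof.
have [A AE pA] := factor_at_p p_pr p2 zn pF.
have zz1 : (z - 1)^* = - z^* * (z - 1).
  have := prim_root_mul_conj 1 zn; rewrite expr1 => zz.
  by rewrite rmorphB rmorph1 /=; transitivity (z^* - z * z^*); [rewrite zz | ring].
have HA : ZZ z (ev A z) by exact: ZZ_ev.
have JA : exists2 b, ZZ z b & ev A z * al^* = al * b.
  exists (- z^* * (ev A z)^*).
    by apply: ZZM; [apply/ZZN/ZZ_conj/ZZ_gen | apply: ZZ_conj].
  by rewrite /al AE rmorphM /= zz1; ring.
have [y [e yE]] : exists y e : int, y * A.[1] = 1 + p%:Z * e.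
  by apply: bezout_one => //; rewrite pA.
have [r Hr Er] := frobenius_iter z A k.+1 p_pr.
rewrite -/n zN ev_at1 in Er.
exists (e%:~R + y%:~R * r); first by zz.
have XE : 1 + p%:R * (e%:~R + y%:~R * r) = y%:~R * ev A z ^+ n.
  rewrite Er; transitivity ((1 + p%:Z * e)%:~R + p%:R * y%:~R * r).
    by rewrite rmorphD rmorphM /=; ring.
  by rewrite -yE rmorphM /=; ring.
split; first by rewrite XE; zz.
have [b Hb Eb] := JA; exists (y%:~R * ev A z ^+ n.-1 * b); first by zz.
rewrite XE -(prednK (ltnW n1)) exprS /=.
transitivity (y%:~R * ev A z ^+ n.-1 * (ev A z * al^*)); first by ring.
by rewrite Eb; ring.
Qed.

(** An inverse [y] modulo [q] of the q-free part of the norm brings [al * al'] to the shape q^v (1 +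
    q e) required for local divisibility; q^c = -1 makes conjugation the q^c-th power map modulo
    [q]. *)
Lemma J_at_q q c : prime q -> (q%:Z %| N)%Z -> (0 < c)%N -> (n %| q ^ c + 1)%N ->
  exists2 r, ZZ z r & J (1 + q%:R * r).
Proof.
move=> q_pr qN c0 nc; have q1 := prime_gt1 q_pr.
have [al' Ha' aE] := norm_cofactor.
have [N' N'q NE'] : exists2 N' : int, ~~ (q%:Z %| N')%Z & N = (q%:Z ^+ logn q `|N|) * N'.
  have : ((q ^ logn q `|N|)%N%:Z %| N)%Z by rewrite dvdzE /= pfactor_dvdn ?lt0n ?absz_eq0.
  case/dvdzP=> N' NE'; exists N'; last by rewrite {1}NE' mulrC -natz natrX natz.
  apply/negP=> /dvdzP[m mE].
  have : ((q ^ (logn q `|N|).+1)%N%:Z %| N)%Z.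
    by apply/dvdzP; exists m; rewrite {1}NE' mE expnS PoszM -mulrA.
  by rewrite dvdzE /= pfactor_dvdn ?lt0n ?absz_eq0 // ltnn.
move: (logn q `|N|) NE' => v NE'; have [y [e yE]] := bezout_one q_pr N'q.
have [h hE] : exists h, (q ^ (c + c) = h.+2)%N.
  exists (q ^ (c + c)).-2; have : (q ^ 1 <= q ^ (c + c))%N by rewrite leq_exp2l //; lia.
  by rewrite expn1; lia.
have qcc : (q ^ (c + c) = 1 %[mod n])%N.
  apply/eqP; rewrite eqn_mod_dvd ?expn_gt0 ?(ltnW q1) //.
  rewrite expnD -[X in (_ - X)%N](exp1n 2) mulnn subn_sqr dvdn_mull //.
have [||||||r [b [Hr Hb E]]] := @conj_locally_divisible z q (q ^ c) h Num.conj (ltnW q1) _ ZZ_conj _ _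
  v al (al' * y%:~R) e%:~R (ZZ_ev z F) _ _ _.
- by rewrite expn_gt0 ltnW.
- move=> x [G ->]; have := frobenius_iter z G c q_pr.
  have -> : z ^+ (q ^ c) = z^*.
    have z0 : z != 0 by rewrite (prim_root_eq0 zn) -lt0n ltnW.
    apply: (mulfI z0); rewrite -exprS -addn1.
    have := prim_root_mul_conj 1 zn; rewrite expr1 => ->.
    by apply/eqP; rewrite -(prim_order_dvd zn).
  by rewrite -ev_rmorph.
- by move=> x Hx; rewrite -hE; apply: frobenius_period.
- by zz.
- by zz.
- transitivity ((q%:Z ^+ v * (y * N'))%:~R : algC); last first.
    by rewrite yE !(rmorphM, rmorphD, rmorphXn).
  by rewrite mulrA -aE NE' !rmorphM /=; ring.
exists r => //; split; first by zz.
by exists b.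
Qed.

(* Off the primes dividing [N], [al] is invertible; at those of even order and at [p], the ideal
   [(al)] is stable under conjugation. *)
Lemma conj_associate :
  (forall q, prime q -> q != p -> (q%:Z %| N)%Z -> exists2 c, (0 < c)%N & (n %| q ^ c + 1)%N) ->
  exists s, ev F z^* = - z ^+ s * ev F z.
Proof.
move=> Hq; have [al' Ha' aE] := norm_cofactor.
have [_ [b Hb Eb]] : J 1.
  apply: (@ideal_contains_one z p J `|N|%N) => //.
  - move=> x y [Hx [b Hb Eb]] [Hy [d Hd Ed]]; split; first zz.
    by exists (b + d); [zz | rewrite mulrDl Eb Ed mulrDr].
  - move=> x y Hx [Hy [d Hd Ed]]; split; first zz.
    by exists (x * d); [zz | rewrite -mulrA Ed; ring].
  - exact: prime_gt0.
  - by rewrite lt0n absz_eq0.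
  - split; first zz; have Hc := ZZ_conj (ZZ_ev z F).
    exists (((-1) ^+ (N < 0)%R)%:~R * (al' * al^*)).
      by rewrite -/al in Hc; zz.
    have -> : (`|N|%N)%:R = ((-1) ^+ (N < 0)%R)%:~R * N%:~R :> algC.
      by rewrite natr_absz {1}normrEsign rmorphM.
    by rewrite aE; ring.
  - move=> q q_pr qN; have [->|qp] := eqVneq q p; first exact: J_at_p.
    have qN' : (q%:Z %| N)%Z by rewrite dvdzE.
    by have [c c0 nc] := Hq q q_pr qp qN'; apply: J_at_q nc.
rewrite mul1r in Eb.
have cE : ev F z^* = al^* by rewrite -(ev_rmorph Num.conj).
have al0 : al != 0.
  apply: contraNneq N0 => al0; have := aE; rewrite al0 mul0r => /eqP.
  by rewrite intr_eq0.
have bb : b * b^* = 1.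
  by apply: (mulfI al0); rewrite mulr1 mulrA -Eb -rmorphM /= -Eb conjCK.
have [s [bE|bE]] := unit_circle_cyclotomic p_pr zn Hb bb; last first.
  by exists s; rewrite cE Eb bE mulrC.
(* With the sign +, F(X^(n-1)) - X^s F would vanish at z, so p would divide its derivative at 1.
   That derivative is -2 F'(1) modulo p. *)
case/negP: pF'.
have : (p%:Z %| ((F \Po 'X^(n.-1)) - 'X^s * F)^`().[1])%Z.
  apply: (deriv1_dvd (A := 0) p_pr p2 zn).
  by rewrite ev0 mulr0 !evE -(prim_root_conj zn) cE Eb bE -/al mulrC subrr.
rewrite derivB deriv_comp derivM !derivXn !hornerE horner_comp !hornerE !expr1n
  !hornerMn !hornerXn !expr1n.
move=> H; have : (p%:Z %| 2 * F^`().[1])%Z.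
  have -> : 2 * F^`().[1] = n%:Z * F^`().[1] - s%:Z * F.[1] -
      (F^`().[1] * n.-1%:R - (s%:R * F.[1] + F^`().[1])).
    rewrite -[n in n%:Z](prednK (ltnW n1)) -!natz -addn1 natrD !natz; ring.
  rewrite rpredB //; last first.
    by move: H; rewrite mul1r.
  rewrite rpredB ?(dvdz_mull _ pF) // dvdz_mulr // /n dvdzE /= expnS dvdn_mulr //.
have cp2 : coprimez p%:Z 2 by rewrite coprimezE /= prime_coprime // gtnNdvd.
by rewrite Gauss_dvdzr.
Qed.

Lemma all_or_has (s : seq nat) (P Q : nat -> Prop) :
  (forall x, x \in s -> P x \/ Q x) -> (exists2 x, x \in s & P x) \/ (forall x, x \in s -> Q x).
Proof.
elim: s => [|x s IH] H; first by right.
have [Px|Qx] := H x (mem_head _ _); first by left; exists x; rewrite ?mem_head.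
have [|[y ys Py]|Qs] := IH; first by move=> y ys; apply: H; rewrite inE ys orbT.
  by left; exists y => //; rewrite inE ys orbT.
by right=> y; rewrite inE => /orP[/eqP ->|/Qs].
Qed.

Lemma prime_power_or_conj :
  (exists q a, [/\ prime q, odd a, (q ^ a = 1 %[mod n])%N & ((q ^ a)%N%:Z %| N)%Z]) \/
  (exists s, ev F z^* = - z ^+ s * ev F z).
Proof.
have [|[q qs [qp [a ao [aE aN]]]]|H] := @all_or_has (primes `|N|)
   (fun q => q != p /\ exists2 a, odd a & (q ^ a = 1 %[mod n])%N /\ ((q ^ a)%N%:Z %| N)%Z)
   (fun q => q = p \/ exists2 c, (0 < c)%N & (n %| q ^ c + 1)%N).
- move=> q; rewrite mem_primes => /and3P[q_pr _ qN].
  have [->|qp] := eqVneq q p; first by right; left.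
  by have [] := odd_order_or_conj q_pr qp qN; [left | right; right].
- by left; exists q, a; split=> //; move: qs; rewrite mem_primes => /and3P[].
right; apply: conj_associate => q q_pr qp qN.
have [|qp'|//] := H q; last by rewrite qp' eqxx in qp.
by rewrite mem_primes q_pr lt0n absz_eq0 N0.
Qed.

End Dichotomy.

(** * Divisibility by p *)

(** By Frobenius, each factor raised to the power p^t is congruent to F(1) modulo p. *)
Lemma dvd_at1 p t (w : algC) F (M : int) : prime p -> (p ^ t).-primitive_root w ->
  M%:~R = \prod_(i < p ^ t) ev F (w ^+ i) -> (p%:Z %| M)%Z -> (p%:Z %| F.[1])%Z.
Proof.
move=> p_pr wn ME pM.
have wA : w \in Aint := Aint_prim_root wn.
have H : eqq w p ((M ^+ (p ^ t))%:~R) ((F.[1] ^+ (p ^ t))%:~R).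
  rewrite !rmorphXn /= ME -prodrXl.
  have -> : F.[1]%:~R ^+ (p ^ t) = \prod_(i < p ^ t) F.[1]%:~R :> algC.
    by rewrite prodr_const card_ord.
  apply: eqq_prod => [i _|i _]; first exact: ZZ_int.
  have := frobenius_iter w (F \Po 'X^i) t p_pr.
  by rewrite !evE (prim_expr_order wn) expr1n ev_at1.
have p0 : p != 0%N by rewrite -lt0n prime_gt0.
have := eqq_int wA p0 H; rewrite eqz_mod_dvd.
have n0 : (0 < p ^ t)%N by rewrite expn_gt0 prime_gt0.
have pM' : M ^+ (p ^ t) \in dvdz p by rewrite -(prednK n0) exprS dvdz_mulr.
rewrite rpredBl // => H'; move: H'; rewrite !dvdzE /= abszX.
by rewrite Euclid_dvdX // => /andP[].
Qed.

(** The norm of 1 - z is the value of the cyclotomic polynomial at 1, that is p; [e] collects the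
    signs. *)
Lemma nrm_factor p k (z : algC) F A : prime p -> (p ^ k.+1).-primitive_root z ->
  ev F z = (z - 1) * ev A z ->
  exists2 e, e \in Aint & nrm F z (p ^ k.+1) = p%:R * e * nrm A z (p ^ k.+1).
Proof.
move=> p_pr zn E.
exists (\prod_(c < p ^ k.+1 | coprime c (p ^ k.+1)) (-1)).
  by apply: rpred_prod => c _; rewrite rpredN.
have -> : p%:R = \prod_(c < p ^ k.+1 | coprime c (p ^ k.+1)) (1 - z ^+ c).
  by rewrite -(ev_Cyclotomic _ zn) ev_at1 Cyclotomic_ppow_at1.
rewrite -!big_split /=; apply: eq_bigr => c cn.
have [u uE] := prim_root_aut zn cn.
rewrite -uE E rmorphM uE rmorphB rmorph1 /=.
have -> : u z = z ^+ c by have := uE 'X; rewrite !evX.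
by ring.
Qed.

Lemma nrm_Aint n (z : algC) F : n.-primitive_root z -> nrm F z n \in Aint.
Proof.
move=> zn; apply: (@ZZ_Aint z); first exact: Aint_prim_root zn.
by apply: ZZ_prod => c _; exists (F \Po 'X^c); rewrite !evE.
Qed.

Lemma p_dvd_nrm p k (z : algC) F (N : int) : prime p -> (2 < p)%N ->
  (p ^ k.+1).-primitive_root z -> N%:~R = nrm F z (p ^ k.+1) ->
  (p%:Z %| F.[1])%Z -> (p%:Z %| N)%Z.
Proof.
move=> p_pr p2 zn NE pF; have [A AE _] := factor_at_p p_pr p2 zn pF.
have [e eA E] := nrm_factor p_pr zn AE.
apply: (@Aint_dvdz p N (e * nrm A z (p ^ k.+1))).
- by rewrite -lt0n prime_gt0.
- by rewrite rpredM // nrm_Aint.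
- by rewrite NE E mulrA.
Qed.

Lemma p2_dvd_nrm p k (z : algC) F (N : int) : prime p -> (2 < p)%N ->
  (p ^ k.+1).-primitive_root z -> N%:~R = nrm F z (p ^ k.+1) ->
  (p%:Z %| F.[1])%Z -> (p%:Z %| F^`().[1])%Z -> ((p ^ 2)%N%:Z %| N)%Z.
Proof.
move=> p_pr p2 zn NE pF; have [A AE <-] := factor_at_p p_pr p2 zn pF => pA.
have [B BE _] := factor_at_p p_pr p2 zn pA.
have [e eA E] := nrm_factor p_pr zn AE.
have [e' e'A E'] := nrm_factor p_pr zn BE.
apply: (@Aint_dvdz _ N (e * e' * nrm B z (p ^ k.+1))).
- by rewrite -lt0n expn_gt0 prime_gt0.
- by rewrite !rpredM // nrm_Aint.
- by rewrite NE E E' natrX; ring.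
Qed.

Lemma prim_p_factor p (x : algC) : prime p -> p.-primitive_root x ->
  exists2 v, ZZ x v & p%:R = (1 - x) ^+ p.-1 * v.
Proof.
move=> p_pr xp; have p0 := prime_gt0 p_pr.
have := ev_Cyclotomic 1 xp; rewrite ev_at1 -{1}[p in 'Phi_p]expn1 Cyclotomic_ppow_at1 // => pE.
rewrite -[p%:R]/((p%:Z)%:~R : algC) pE {pE}.
case: p p_pr p0 xp => // p p_pr _ xp.
rewrite big_mkcond big_ord_recl /= /coprime gcd0n gtn_eqF ?prime_gt1 // mul1r.
exists (\prod_(i < p) \sum_(j < i.+1) x ^+ j).
  apply: ZZ_prod => i _; rewrite -[X in ZZ x X](_ : ev (\sum_(j < i.+1) 'X^j) x = _).
    exact: ZZ_ev.
  by rewrite ev_sum; apply: eq_bigr => j _; rewrite evXn.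
rewrite -[in X in X * _](card_ord p) -prodr_const -big_split /=.
apply: eq_bigr => i _; rewrite ifT; last first.
  by rewrite -/(coprime _ _) coprime_sym prime_coprime // gtnNdvd //= /bump add1n ltnS.
by rewrite -[1 - x]opprB mulNr -subrX1 opprB.
Qed.

(* The valuation of [1 - z^e] at [1 - z] is too small for [p^b] to divide the left-hand side
   unless [1 - z] divides [G z] twice. *)
Lemma deriv1_dvd_of_unit_multiple p k (z : algC) G H e b : prime p -> (2 < p)%N ->
  (p ^ k.+1).-primitive_root z -> (0 < b)%N -> (0 < k)%N || (2 < b * p.-1)%N ->
  z ^+ e != 1 -> (1 - z ^+ e) * ev G z = p%:R ^+ b * ev H z ->
  (p%:Z %| G^`().[1])%Z.
Proof.
move=> p_pr p2 zn b0 kb ze E; have p1 := prime_gt1 p_pr.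
have sub1 r : exists S, 1 - z ^+ r = (1 - z) * ev S z.
  exists (\sum_(j < r) 'X^j); rewrite ev_sum.
  under eq_bigr do rewrite evXn.
  by rewrite -[1 - z]opprB mulNr -subrX1 opprB.
(* A p-power multiple [r] of [e] gives a root of order exactly p. As 1 - z^r is a multiple of 1 -
   z^e and its (p-1)-th power divides p, it can replace 1 - z^e in the estimate. *)
have [r rp [S SE]] : exists2 r, p.-primitive_root (z ^+ r) &
    exists S, 1 - z ^+ r = (1 - z ^+ e) * ev S z.
  have := exp_prim_root zn e; set d := (_ %/ _)%N => zed.
  have [m _ dE] : exists2 m, (m <= k.+1)%N & d = (p ^ m)%N.
    apply/(dvdn_pfactor _ _ p_pr); rewrite /d.
    by apply/dvdnP; exists (gcdn e (p ^ k.+1)); rewrite mulnC divnK // dvdn_gcdr.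
  case: m dE => [dE|m dE].
    by move: ze; rewrite -[z ^+ e]expr1 -(prim_order_dvd zed) dE dvd1n.
  rewrite dE in zed; have := dvdn_prim_root zed (_ : p %| p ^ m.+1)%N.
  rewrite expnS mulKn ?prime_gt0 // dvdn_mulr // => /(_ isT) H'.
  exists (e * p ^ m)%N; first by rewrite exprM.
  exists (\sum_(j < p ^ m) 'X^(e * j)); rewrite ev_sum.
  under eq_bigr do rewrite evXn exprM.
  by rewrite exprM -[1 - z ^+ e]opprB mulNr -subrX1 opprB.
set x := 1 - z ^+ r in SE.
have [v Hv pE] := prim_p_factor p_pr rp; rewrite -/x in pE.
have {}Hv : ZZ z v by apply: ZZ_sub Hv; zz.
have x0 : x != 0.
  rewrite subr_eq0 eq_sym; apply: contraTneq rp => xE; apply/negP => rp.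
  by have := prim_order_dvd rp 1; rewrite expr1 xE eqxx dvdn1 => /eqP p1'; rewrite p1' in p1.
have [S1 xE] := sub1 r; rewrite -/x in xE.
have bp : (2 <= b * p.-1)%N.
  by case: (b) b0 => // b' _; rewrite mulSn; apply: leq_trans (leq_addr _ _); lia.
have GE : ev G z = x ^+ (b * p.-1).-2.+1 * (v ^+ b * ev H z * ev S z).
  apply: (mulfI x0).
  rewrite SE; transitivity ((1 - z ^+ e) * ev G z * ev S z); first by ring.
  rewrite E -SE -/x.
  transitivity (x ^+ (b * p.-1).-2.+2 * (v ^+ b * ev H z * ev S z)); last by rewrite !exprS; ring.
  have -> : (b * p.-1).-2.+2 = (b * p.-1)%N by lia.
  by rewrite pE exprMn -exprM [(p.-1 * b)%N]mulnC; ring.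
(* For k > 0, [x] alone is divisible by (1 - z)^2: p^k divides [r], so [x] is a p^k-th power modulo
   p, and p itself is divisible by (1 - z)^2. For k = 0 the exponent of [x] is at least 2. *)
have [Y HY [m mE]] : exists2 Y, ZZ z Y & exists m, x ^+ (b * p.-1).-2.+1 = (1 - z) ^+ 2 * Y * x ^+ m.
  case/orP: kb => [k0|bp3].
    have pk : (p ^ k %| r)%N.
      have : z ^+ (r * p) == 1 by rewrite exprM (prim_expr_order rp).
      by rewrite -(prim_order_dvd zn) expnSr dvdn_pmul2r ?prime_gt0.
    have [r' rE] := dvdnP pk.
    have [y Hy yE] := frobenius_iter z (1 - 'X^r') k p_pr.
    have yE' : (1 - z ^+ r') ^+ (p ^ k) = x + p%:R * y.
      by move: yE; rewrite !evE => ->; rewrite /x rE mulnC exprM.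
    have [S2 S2E] := sub1 r'.
    have k2 : (p ^ k = (p ^ k).-2.+2)%N.
      have : (p ^ 1 <= p ^ k)%N by rewrite leq_exp2l.
      by rewrite expn1; lia.
    have pE' : p.-1 = p.-2.-1.+2 by lia.
    exists (((1 - z) ^+ (p ^ k).-2) * ev S2 z ^+ (p ^ k) - ev S1 z ^+ 2 * x ^+ p.-2.-1 * v * y).
      by rewrite /x; zz.
    exists (b * p.-1).-2; rewrite exprS; congr (_ * _).
    have W1 : (1 - z ^+ r') ^+ (p ^ k) = (1 - z) ^+ 2 * ((1 - z) ^+ (p ^ k).-2 * ev S2 z ^+ (p ^ k)).
      by rewrite mulrA -exprD add2n -k2 S2E exprMn.
    have W2 : p%:R = (1 - z) ^+ 2 * (ev S1 z ^+ 2 * x ^+ p.-2.-1 * v).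
      by rewrite pE pE' -add2n exprD {1}xE; ring.
    by rewrite -[LHS](addrK (p%:R * y)) -yE' W1 W2; ring.
  exists (ev S1 z ^+ 2); first by zz.
  exists (b * p.-1).-2.-1; have -> : (b * p.-1).-2.+1 = ((b * p.-1).-2.-1.+2)%N by lia.
  by rewrite !exprS {1 2}xE; ring.
have Hx : ZZ z x by rewrite /x; zz.
have [A AE] : ZZ z (Y * x ^+ m * (v ^+ b * ev H z * ev S z)) by zz.
apply: (@deriv1_dvd p k z G A) => //.
by rewrite GE mE -AE; ring.
Qed.

Lemma prod_Cyclotomic_dvd p (w : nat -> algC) (ks : seq nat) A : prime p ->
  uniq ks -> (forall k, k \in ks -> (p ^ k).-primitive_root (w k)) ->
  (forall k, k \in ks -> ev A (w k) = 0) ->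
  exists H, A = (\prod_(k <- ks) 'Phi_(p ^ k)) * H.
Proof.
move=> p_pr; elim: ks => [|k ks IH] /=; first by exists A; rewrite big_nil mul1r.
case/andP=> kks uks wP A0.
have [||H AE] := IH uks.
- by move=> k' k'ks; apply: wP; rewrite inE k'ks orbT.
- by move=> k' k'ks; apply: A0; rewrite inE k'ks orbT.
have wk := wP k (mem_head _ _).
have Hk : ev H (w k) = 0.
  have /eqP := A0 k (mem_head _ _); rewrite AE evM mulf_eq0 ev_prod => /orP[|/eqP //].
  rewrite prodf_seq_eq0 => /hasP[k' k'ks /= /eqP].
  have wk' := wP k' (_ : k' \in k :: ks); rewrite inE k'ks orbT in wk'.
  move=> E; have : root (cyclotomic (w k') (p ^ k')) (w k).
    by rewrite -(Cintr_Cyclotomic (wk' isT)) /root -[_.[_]]/(ev _ _) E.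
  rewrite (root_cyclotomic (wk' isT)) => wk2.
  have := prim_order_dvd wk (p ^ k'); rewrite (prim_expr_order wk2) eqxx.
  have := prim_order_dvd wk2 (p ^ k); rewrite (prim_expr_order wk) eqxx.
  rewrite !dvdn_Pexp2l ?prime_gt1 // => k1 k2.
  have kk : k = k' by apply/eqP; rewrite eqn_leq k1 k2.
  by rewrite kk k'ks in kks.
have [H' HE] := Cyclotomic_dvd wk Hk.
by exists H'; rewrite big_cons AE HE; ring.
Qed.

(** * Counting the levels with an anti-invariant value *)

Section Counting.
Variables (p t : nat) (w : algC) (F : {poly int}).
Hypotheses (p_pr : prime p) (p2 : (2 < p)%N) (wn : (p ^ t).-primitive_root w).
Hypotheses (pF : (p%:Z %| F.[1])%Z) (pF' : ~~ (p%:Z %| F^`().[1])%Z).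

Let zk k := w ^+ (p ^ (t - k)).
Let bad k := exists s, ev F (zk k)^* = - zk k ^+ s * ev F (zk k).

Lemma prim_root_level k : (k <= t)%N -> (p ^ k).-primitive_root (zk k).
Proof.
move=> kt; have := dvdn_prim_root wn (dvdn_exp2l p kt).
by rewrite -expnB ?prime_gt0.
Qed.

(* [A] is the symmetrization [G(x) + G(1/x)] of a translate [G = x^c F] chosen so that the
   relation at level [K] reads [G(1/zeta) = - G(zeta)]. *)
Lemma symmetrization K : (0 < K <= t)%N -> bad K ->
  exists A, [/\ A.[1] = 2 * F.[1], ev A (zk K) = 0 &
    forall k, (0 < k <= t)%N -> bad k -> exists e G,
      ~~ (p%:Z %| G^`().[1])%Z /\ ev A (zk k) = (1 - zk k ^+ e) * ev G (zk k)].
Proof.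
move=> Kt [s sE]; pose n := (p ^ t)%N.
have n0 : (0 < n)%N by rewrite expn_gt0 prime_gt0.
have p_odd : odd p by case: (even_prime p_pr) => [p2'|//]; move: p2; rewrite p2'.
have n_odd : odd n by rewrite oddX p_odd orbT.
(* As [n] is odd, [c] is half of [s] modulo [n], so the translate X^c F turns the factor -z^s into
   -1. Below, X^(n-1) plays the role of 1/x at all levels at once. *)
pose c := (s * n.+1./2)%N.
have c2 : (c * 2 = s * n.+1)%N.
  by rewrite -mulnA muln2 -[in RHS](odd_double_half n.+1) /= n_odd.
pose G : {poly int} := 'X^c * F.
have zn k : zk k ^+ n = 1 by rewrite /zk exprAC (prim_expr_order wn) expr1n.
have zc k : (k <= t)%N -> (zk k)^* = zk k ^+ n.-1.
  move=> kt; have zkp := prim_root_level kt.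
  have z0 : zk k != 0 by rewrite (prim_root_eq0 zkp) -lt0n expn_gt0 prime_gt0.
  have := prim_root_mul_conj 1 zkp; rewrite expr1 => zz.
  by apply: (mulfI z0); rewrite zz -exprS prednK.
have AE k sk : (k <= t)%N -> ev F (zk k)^* = - zk k ^+ sk * ev F (zk k) ->
    ev (G + (G \Po 'X^(n.-1))) (zk k) =
    (1 - zk k ^+ (sk + n.-1 * (c * 2))) * ev G (zk k).
  move=> kt skE; rewrite !evE -(zc k kt) skE (zc k kt) exprD exprM.
  set y := zk k ^+ n.-1; have yz : y * zk k = 1 by rewrite -exprSr prednK ?zn.
  have yzc : y ^+ c * zk k ^+ c = 1 by rewrite -exprMn yz expr1n.
  rewrite exprM expr2; transitivity (zk k ^+ c * ev F (zk k) -
      zk k ^+ sk * y ^+ c * (y ^+ c * zk k ^+ c) * ev F (zk k)).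
    by rewrite yzc; ring.
  by ring.
exists (G + (G \Po 'X^(n.-1))); split.
- by rewrite hornerD horner_comp hornerXn expr1n hornerM hornerXn expr1n mul1r mulr_natl mulr2n.
- have /andP[_ K_t] := Kt.
  rewrite (AE K s K_t sE) c2 (_ : _ ^+ _ = 1) ?subrr ?mul0r //.
  have -> : (s + n.-1 * (s * n.+1) = n * (s * n))%N.
    by case: (n) n0 => // m _ /=; nia.
  by rewrite exprM zn expr1n.
- move=> k /andP[_ kt] [sk skE]; exists (sk + n.-1 * (c * 2))%N, G; split; last exact: AE.
  rewrite /G derivM derivXn hornerD !hornerM hornerXn expr1n hornerMn hornerXn expr1n mul1r.
  by rewrite rpredDl // dvdz_mull.
Qed.

(** Unless zk^e = 1, the power p^b would force p to divide G'(1). The condition on [k] and [b]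
    excludes only p = 3, k = 1, b = 1. *)
Lemma bad_vanish k A C H e G b : (0 < k <= t)%N -> A = C * H -> ev C (zk k) = p%:R ^+ b ->
  (0 < b)%N -> (1 < k)%N || (2 < b * p.-1)%N ->
  ~~ (p%:Z %| G^`().[1])%Z -> ev A (zk k) = (1 - zk k ^+ e) * ev G (zk k) ->
  ev A (zk k) = 0.
Proof.
case: k => // k /= kt AE CE b0 kb pG E.
have zp := prim_root_level kt.
have [ze|ze] := eqVneq (zk k.+1 ^+ e) 1; first by move: E; rewrite ze subrr mul0r.
case/negP: pG; apply: (deriv1_dvd_of_unit_multiple (H := H) p_pr p2 zp b0 kb ze).
by rewrite -E AE evM CE.
Qed.

(** The symmetrization is centred at the largest level K: ['Phi_(p ^ K)] divides it and takes the
    value p at every lower level, so [bad_vanish] applies with b = 1. *)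
Lemma bad_common ks : ks != [::] -> uniq ks -> (forall k, k \in ks -> (0 < k <= t)%N /\ bad k) ->
  (4 < p)%N \/ (forall k, k \in ks -> (1 < k)%N) ->
  exists A, [/\ A.[1] = 2 * F.[1], forall k, k \in ks -> ev A (zk k) = 0 &
    forall k, (0 < k <= t)%N -> bad k -> exists e G,
      ~~ (p%:Z %| G^`().[1])%Z /\ ev A (zk k) = (1 - zk k ^+ e) * ev G (zk k)].
Proof.
move=> ks0 uks ksP big.
have exK : exists k, k \in ks by case: (ks) ks0 => // k s _; exists k; rewrite mem_head.
have leT k : k \in ks -> (k <= t)%N by case/ksP => /andP[].
case: (ex_maxnP exK leT) => K Kks Kmax.
have [Kt Kbad] := ksP K Kks.
have [A [A1 AK Ak]] := symmetrization Kt Kbad; exists A; split=> // k kks.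
have [kt kbad] := ksP k kks.
have [<-//|kK] := eqVneq K k.
have ltkK : (k < K)%N by rewrite ltn_neqAle eq_sym kK Kmax.
have KS : K = K.-1.+1 by rewrite prednK //; case/andP: Kt.
have zK : (p ^ K.-1.+1).-primitive_root (zk K) by rewrite -KS; apply: prim_root_level; case/andP: Kt.
have [H AE] := Cyclotomic_dvd zK AK.
have [e [G [pG E]]] := Ak k kt kbad.
apply: (bad_vanish kt AE (b := 1) _ _ _ pG E) => //.
  rewrite expr1; apply: ev_Cyclotomic_low => //; apply/eqP.
  have /andP[_ kt'] := kt.
  by rewrite -(prim_order_dvd (prim_root_level kt')) dvdn_exp2l // -ltnS -KS.
by case: big => [p4|/(_ k kks) -> //]; apply/orP; right; lia.
Qed.

Lemma dvd_of_vanish ks A : uniq ks -> (forall k, k \in ks -> (0 < k <= t)%N) ->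
  A.[1] = 2 * F.[1] -> (forall k, k \in ks -> ev A (zk k) = 0) ->
  ((p ^ size ks)%N%:Z %| F.[1])%Z.
Proof.
move=> uks ksP A1 A0.
have [|H AE] := prod_Cyclotomic_dvd (w := zk) p_pr uks _ A0.
  by move=> k /ksP /andP[_ kt]; apply: prim_root_level.
have : ((p ^ size ks)%N%:Z %| 2 * F.[1])%Z.
  rewrite -A1 AE hornerM dvdz_mulr // horner_prod.
  have -> : \prod_(k <- ks) ('Phi_(p ^ k)).[1] = (p ^ size ks)%N%:Z.
    elim: (ks) ksP => [|k s IH] sP; first by rewrite big_nil.
    rewrite big_cons IH => [|k' k's]; last by apply: sP; rewrite inE k's orbT.
    have /andP[k0 _] := sP k (mem_head _ _).
    by rewrite -(prednK k0) Cyclotomic_ppow_at1 //= expnS PoszM.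
  by [].
rewrite Gauss_dvdzr // coprimezE /=; apply: coprimeXl.
by rewrite prime_coprime // gtnNdvd.
Qed.

Lemma bad_dvd ks : uniq ks -> (forall k, k \in ks -> (0 < k <= t)%N /\ bad k) ->
  (4 < p)%N \/ (forall k, k \in ks -> (1 < k)%N) -> ((p ^ size ks)%N%:Z %| F.[1])%Z.
Proof.
move=> uks ksP big; have [->|ks0] := eqVneq ks [::]; first by rewrite dvdzE /= dvd1n.
have [A [A1 A0 _]] := bad_common ks0 uks ksP big.
by apply: (dvd_of_vanish uks _ A1 A0) => k /ksP [].
Qed.

(** Two higher levels supply b >= 2 at level 1, which covers p = 3 as well. With no higher level the
    symmetrization is centred at 1 itself; a single higher level is the case that escapes. *)
Lemma bad_dvd_with1 ks : uniq ks -> (forall k, k \in ks -> (0 < k <= t)%N /\ bad k) ->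
  (forall k, k \in ks -> (1 < k)%N) -> size ks != 1%N -> (0 < 1 <= t)%N -> bad 1 ->
  ((p ^ (size ks).+1)%N%:Z %| F.[1])%Z.
Proof.
move=> uks ksP ks2 sks t1 bad1.
have u1 : uniq (1%N :: ks) by rewrite /= uks andbT; apply/negP => /ks2.
have P1 k : k \in 1%N :: ks -> (0 < k <= t)%N.
  by rewrite inE => /orP[/eqP ->|/ksP []].
rewrite -[(size ks).+1]/(size (1%N :: ks)).
have [ks0|ks0] := eqVneq ks [::].
  have [A [A1 A0 _]] := symmetrization t1 bad1.
  by apply: (dvd_of_vanish u1 P1 A1) => k; rewrite ks0 inE => /eqP ->.
have [A [A1 A0 Ak]] := bad_common ks0 uks ksP (or_intror ks2).
apply: (dvd_of_vanish u1 P1 A1) => k; rewrite inE => /orP[/eqP ->|]; last exact: A0.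
have [|H AE] := prod_Cyclotomic_dvd (w := zk) p_pr uks _ A0.
  by move=> k' /ksP [/andP[_ kt] _]; apply: prim_root_level.
have [e [G [pG E]]] := Ak 1%N t1 bad1.
have s2 : (1 < size ks)%N by case: (ks) ks0 sks => [//|x [|y s]].
apply: (bad_vanish t1 AE (b := size ks) _ _ _ pG E); last 2 first.
- exact: ltnW.
- apply/orP; right; have H4 : (2 * 2 <= size ks * p.-1)%N by apply: leq_mul => //; lia.
  exact: leq_trans H4.
rewrite ev_prod; elim: (ks) ks2 => [|k' s IH] sP; first by rewrite big_nil.
rewrite big_cons IH => [|k'' k's]; last by apply: sP; rewrite inE k's orbT.
rewrite exprS; congr (_ * _).
have k'1 : (1 < k')%N := sP k' (mem_head _ _).
rewrite -(prednK (ltnW k'1)); apply: ev_Cyclotomic_low => //; apply/eqP.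
by rewrite -(prim_order_dvd (prim_root_level _)) ?dvdn_exp2l //; lia.
Qed.

End Counting.

(** * Products and choices over finite sets of levels *)

Lemma prodz_dvd (I : eqType) (r : seq I) (d : I -> nat) (N : I -> int) :
  (forall k, k \in r -> ((d k)%:Z %| N k)%Z) ->
  ((\prod_(k <- r) d k)%N%:Z %| \prod_(k <- r) N k)%Z.
Proof.
elim: r => [|k r IH] H; first by rewrite !big_nil dvdzz.
rewrite !big_cons PoszM dvdz_mul ?H ?mem_head // IH // => k' k'r.
by apply: H; rewrite inE k'r orbT.
Qed.

Lemma prod_sub_dvdz (G r : seq nat) (N : nat -> int) : uniq G -> uniq r -> {subset G <= r} ->
  (\prod_(k <- G) N k %| \prod_(k <- r) N k)%Z.
Proof.
move=> uG ur sub; rewrite [X in (_ %| X)%Z](bigID (mem G)) /= -big_filter.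
rewrite (perm_big G) ?dvdz_mulr //.
apply: uniq_perm; rewrite ?filter_uniq // => k; rewrite mem_filter /= andb_idr //.
exact: sub.
Qed.

(** [G] is delivered sorted so that its i-th level can be bounded below. *)
Lemma split_range (P Q : nat -> Prop) lo n :
  (forall k, (lo <= k < lo + n)%N -> P k \/ Q k) ->
  exists G B, [/\ sorted ltn G, uniq B, (size G + size B = n)%N,
    forall k, k \in G -> (lo <= k < lo + n)%N /\ P k &
    forall k, k \in B -> (lo <= k < lo + n)%N /\ Q k].
Proof.
elim: n => [|n IH] H; first by exists [::], [::].
have [|G [B [sG uB sz GP BQ]]] := IH.
  by move=> k /andP[h1 h2]; apply: H; rewrite h1 addnS ltnS ltnW.
have wide k : (lo <= k < lo + n)%N -> (lo <= k < lo + n.+1)%N.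
  by case/andP=> -> h; rewrite addnS ltnS ltnW.
have top : (lo <= lo + n < lo + n.+1)%N by rewrite leq_addr addnS ltnS leqnn.
have [Pn|Qn] := H _ top.
- exists (rcons G (lo + n)%N), B; split=> //.
  + case: (G) sG GP => [//|x s] /= sG GP; rewrite rcons_path sG /=.
    by have [/andP[]] := GP _ (mem_last x s).
  + by rewrite size_rcons addSn sz.
  + by move=> k; rewrite mem_rcons inE => /orP[/eqP ->|/GP [/wide]].
  + by move=> k /BQ [/wide].
- exists G, ((lo + n)%N :: B); split=> //=.
  + by rewrite uB andbT; apply/negP => /BQ [/andP[_]]; rewrite ltnn.
  + by rewrite addnS sz.
  + by move=> k /GP [/wide].
  + by move=> k; rewrite inE => /orP[/eqP ->|/BQ [/wide]].
Qed.

Lemma choose_on_seq (R : nat -> nat -> nat -> Prop) (G : seq nat) :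
  (forall k, k \in G -> exists q a, R k q a) ->
  exists q a : nat -> nat, forall k, k \in G -> R k (q k) (a k).
Proof.
elim: G => [|x G IH] H; first by exists id, id.
have [|q [a qaP]] := IH; first by move=> k kG; apply: H; rewrite inE kG orbT.
have [q0 [a0 R0]] := H x (mem_head _ _).
exists (fun k => if k == x then q0 else q k), (fun k => if k == x then a0 else a k) => k.
by rewrite inE; case: eqP => [->|_ /= /qaP].
Qed.

Lemma sorted_nth_ge lo (G : seq nat) i : sorted ltn G -> (forall k, k \in G -> (lo <= k)%N) ->
  (i < size G)%N -> (lo + i <= nth 0 G i)%N.
Proof.
move=> sG GP; elim: i => [|i IH] iG; first by rewrite addn0 GP ?mem_nth.
rewrite addnS; apply: leq_ltn_trans (IH (ltnW iG)) _.
by rewrite (sorted_ltn_nth ltn_trans) // inE // ltnW.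
Qed.

(** * Multiples of n^2 as circulant determinants *)

Lemma prod_one_minus_root n (w : algC) : n.+1.-primitive_root w ->
  \prod_(i < n) (1 - w ^+ i.+1) = n.+1%:R.
Proof.
move=> wn; have E := factor_Xn_sub_1 wn.
rewrite big_nat_recl // expr0 subrX1 in E.
have X0 : 'X - 1%:P != 0 :> {poly algC} by rewrite polyXsubC_eq0.
have := mulfI X0 E => /(congr1 (fun P : {poly algC} => P.[1])).
rewrite horner_prod big_mkord horner_sum.
under eq_bigr do rewrite hornerXsubC.
by move=> ->; under eq_bigr do rewrite hornerXn expr1n; rewrite sumr_const card_ord.
Qed.

(** In F = X - 1 + k (1 + X + ... + X^(n-1)) the sum vanishes at the nontrivial n-th roots of unity,
    where the factors x - 1 multiply to n (the sign is + for odd n), and F(1) = k n. *)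
Lemma circ_dets_multiple_sq n (k : int) : odd n -> circ_dets n (n%:Z ^+ 2 * k).
Proof.
case: n => // n n_odd; have [w wn] := C_prim_root_exists (ltn0Sn n).
(* The 1 x 1 case is apart: X - 1 has too many coefficients for a row of length 1. *)
have [n0|n0] := posnP n.
  exists (fun=> k); rewrite n0 (mx11_scalar (circulant _ _)) det_scalar1 mxE.
  by rewrite expr1n mul1r.
pose F : {poly int} := 'X - 1 + k *: \sum_(i < n.+1) 'X^i.
have sF : (size F <= n.+1)%N.
  rewrite (leq_trans (size_polyD _ _)) // geq_max size_XsubC ltnS n0 /=.
  rewrite (leq_trans (size_scale_leq _ _)) // (leq_trans (size_sum _ _ _)) //.
  by apply/bigmax_leqP => i _; rewrite size_polyXn.
exists (fun j => F`_j); apply: (@intr_inj algC); rewrite (det_circulant _ wn).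
have -> : \poly_(j < n.+1) F`_j = F.
  by apply/polyP=> i; rewrite coef_poly; case: ltnP => // H; rewrite nth_default // (leq_trans sF).
have evF x : ev F x = x - 1 + k%:~R * \sum_(i < n.+1) x ^+ i.
  by rewrite /F !evE ev_sum; under eq_bigr do rewrite evXn.
rewrite big_ord_recl expr0 evF subrr add0r.
under eq_bigr do rewrite expr1n; rewrite sumr_const card_ord.
rewrite (eq_bigr (fun i : 'I_n => - (1 - w ^+ i.+1))) => [|i _]; last first.
  rewrite evF; have x1 : w ^+ i.+1 - 1 != 0.
    rewrite subr_eq0 -(prim_order_dvd wn); apply/negP => /dvdn_leq => /(_ isT).
    by rewrite ltnS leqNgt ltn_ord.
  have : (w ^+ i.+1 - 1) * \sum_(j < n.+1) (w ^+ i.+1) ^+ j = 0.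
    by rewrite -subrX1 exprAC (prim_expr_order wn) expr1n subrr.
  move/eqP; rewrite mulf_eq0 (negPf x1) => /eqP.
  by rewrite /= => ->; rewrite mulr0 addr0 opprB.
rewrite prodrN card_ord prod_one_minus_root // -signr_odd.
have -> : odd n = false by move: n_odd => /=; case: (odd n).
by rewrite expr0 mul1r rmorphM rmorphXn /=; ring.
Qed.

(** * From levels to prime powers dividing m *)

Definition good p (N : nat -> int) k := exists q a,
  [/\ prime q, odd a, (q ^ a = 1 %[mod p ^ k])%N & ((q ^ a)%N%:Z %| N k)%Z].

(** The i-th good level, counted from [lo], is at least i, so its congruence can be weakened to p^i.
    Primes may repeat, but each prime power divides the norm of its own level, so the product
    divides p^j m; being 1 modulo p, it is prime to p^j. *)
Lemma good_factors p t lo g (G : seq nat) (N : nat -> int) j (m : int) :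
  prime p -> (0 < lo)%N -> sorted ltn G ->
  (forall k, k \in G -> (lo <= k <= t)%N /\ good p N k) -> (g <= size G)%N ->
  (\prod_(1 <= k < t.+1) N k %| p%:Z ^+ j * m)%Z ->
  exists q a : nat -> nat,
    (forall i, (lo <= i < lo + g)%N ->
       [/\ prime (q i), odd (a i) & (q i ^ a i = 1 %[mod p ^ i])%N]) /\
    ((\prod_(lo <= i < lo + g) (q i ^ a i)%N)%:Z %| m)%Z.
Proof.
move=> p_pr lo0 sG GP gG Nm.
have [|q [a qaP]] := @choose_on_seq
  (fun k q a => [/\ prime q, odd a, (q ^ a = 1 %[mod p ^ k])%N & ((q ^ a)%N%:Z %| N k)%Z]) G.
  by move=> k /GP [].
pose K i := nth 0%N G (i - lo).
have KG i : (lo <= i < lo + g)%N -> K i \in G /\ (i <= K i)%N.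
  move=> /andP[h1 h2]; have h : (i - lo < size G)%N by apply: leq_trans gG; lia.
  split; first exact: mem_nth.
  have := @sorted_nth_ge lo G (i - lo) sG _ h; rewrite subnKC //; apply.
  by move=> k /GP [/andP[]].
exists (q \o K), (a \o K); split=> [i /KG [kG ik]|].
  have [qp ao qa _] := qaP _ kG; split=> //=.
  by have /= := congr1 (modn^~ (p ^ i)%N) qa; rewrite !modn_dvdm ?dvdn_exp2l.
have -> : (\prod_(lo <= i < lo + g) ((q \o K) i ^ (a \o K) i) = \prod_(k <- take g G) q k ^ a k)%N.
  rewrite [RHS](big_nth 0%N) size_takel // -{1}[lo]add0n [(lo + g)%N]addnC big_addn addnK.
  by apply: eq_big_nat => i /andP[_ ig]; rewrite /= /K addnK nth_take.
have uG : uniq G by apply: sorted_uniq sG; [exact: ltn_trans | exact: ltnn].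
have sub : {subset take g G <= G} by move=> x; exact: mem_take.
have D : ((\prod_(k <- take g G) q k ^ a k)%N%:Z %| p%:Z ^+ j * m)%Z.
  apply: dvdz_trans Nm; apply: (@dvdz_trans (\prod_(k <- take g G) N k)).
    by apply: prodz_dvd => k /sub /qaP [].
  apply: prod_sub_dvdz; rewrite ?take_uniq ?iota_uniq // => k /sub /GP [/andP[h1 h2] _].
  by rewrite mem_index_iota (leq_trans lo0 h1) ltnS.
move: D; rewrite Gauss_dvdzr // coprimezE /= abszX; apply: coprimeXr.
have : forall k, k \in take g G -> coprime (q k ^ a k) p.
  move=> k kG; have [_ _ qa _] := qaP k (sub k kG).
  have [/andP[lk _] _] := GP k (sub k kG).
  have pk : (p %| p ^ k)%N by rewrite dvdn_exp // (leq_trans lo0).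
  have : (q k ^ a k = 1 %[mod p])%N.
    by have /= := congr1 (modn^~ p) qa; rewrite !modn_dvdm.
  by rewrite -coprime_modl => ->; rewrite coprime_modl coprime1n.
elim: (take g G) => [|k s IH] H; first by rewrite big_nil coprime1n.
rewrite big_cons coprimeMl H ?mem_head // IH // => k' k's.
by apply: H; rewrite inE k's orbT.
Qed.

(** Both bounds express that p divides each of the t norms, so a power of p in F(1) adds to p^t
    within p^j m. *)
Lemma circ_dets_structure p t j (m : int) : prime p -> (2 < p)%N -> (0 < t)%N ->
  (0 < j < 2 * t)%N -> ~~ (p%:Z %| m)%Z -> circ_dets (p ^ t) (p%:Z ^+ j * m) ->
  exists (N : nat -> int) (bad : nat -> Prop), [/\
    (\prod_(1 <= k < t.+1) N k %| p%:Z ^+ j * m)%Z,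
    forall k, (0 < k <= t)%N -> good p N k \/ bad k,
    forall ks, uniq ks -> (forall k, k \in ks -> (0 < k <= t)%N /\ bad k) ->
      (4 < p)%N \/ (forall k, k \in ks -> (1 < k)%N) -> (size ks + t <= j)%N &
    forall ks, uniq ks -> (forall k, k \in ks -> (0 < k <= t)%N /\ bad k) ->
      (forall k, k \in ks -> (1 < k)%N) -> size ks != 1%N -> bad 1%N -> (size ks + t < j)%N].
Proof.
move=> p_pr p2 t0 /andP[j0 jt] pm [a aE].
have pt0 : (0 < p ^ t)%N by rewrite expn_gt0 prime_gt0.
have [w wn] := C_prim_root_exists pt0.
pose F := \poly_(i < p ^ t) a i.
have ME := det_circulant a wn; rewrite aE -/F in ME.
have m0 : m != 0 by apply: contraNneq pm => ->; rewrite dvdz0.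
have p0 : p%:Z != 0 by rewrite -lt0n prime_gt0.
have M0 : p%:Z ^+ j * m != 0 by rewrite mulf_neq0 // expf_neq0.
have [|N [NE NM]] := @prod_unity_norms p t w F p_pr wn.
  by rewrite -ME intr_eq0.
have {}NM : p%:Z ^+ j * m = F.[1] * \prod_(1 <= k < t.+1) N k.
  by apply: (@intr_inj algC); rewrite ME NM.
have pF : (p%:Z %| F.[1])%Z.
  by apply: (dvd_at1 p_pr wn ME); rewrite -(prednK j0) exprS -mulrA dvdz_mulr.
have zP k : (k <= t)%N -> (p ^ k).-primitive_root (w ^+ (p ^ (t - k))).
  exact: prim_root_level.
have N0 k : (0 < k <= t)%N -> N k != 0.
  move=> /andP[k0 kt]; apply: contraNneq M0 => Nk0.
  rewrite NM (bigD1_seq k) ?iota_uniq ?mem_index_iota ?k0 ?ltnS //=.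
  by rewrite Nk0 mul0r mulr0.
have valM e : ((p ^ e)%N%:Z %| p%:Z ^+ j * m)%Z -> (e <= j)%N.
  move=> H; rewrite leqNgt; apply: contra pm => je.
  have : ((p ^ j.+1)%N%:Z %| p%:Z ^+ j * m)%Z.
    by apply: dvdz_trans H; rewrite dvdzE /= dvdn_exp2l.
  have -> : (p ^ j.+1)%N%:Z = p%:Z ^+ j.+1 by rewrite -natz natrX natz.
  rewrite exprSr => /dvdzP[c]; rewrite [c * _]mulrC -mulrA => /mulfI E.
  by apply/dvdzP; exists c; rewrite E ?expf_neq0 // mulrC.
have pN : ((p ^ t)%N%:Z %| \prod_(1 <= k < t.+1) N k)%Z.
  have -> : (p ^ t = \prod_(1 <= k < t.+1) p)%N by rewrite prod_nat_const_nat subn1.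
  apply: prodz_dvd => k; rewrite mem_index_iota ltnS => kt.
  case: k kt => // k kt; exact: (p_dvd_nrm p_pr p2 (zP k.+1 kt) (NE k.+1 kt) pF).
(* Otherwise p^2 divides all t norms and p divides F(1): valuation 2t + 1 > j. *)
have pF' : ~~ (p%:Z %| F^`().[1])%Z.
  apply/negP => pF'; have : ((p ^ (2 * t).+1)%N%:Z %| p%:Z ^+ j * m)%Z.
    rewrite NM expnS PoszM dvdz_mul //.
    have -> : (p ^ (2 * t) = \prod_(1 <= k < t.+1) p ^ 2)%N.
      by rewrite prod_nat_const_nat subn1 expnM.
    apply: prodz_dvd => k; rewrite mem_index_iota ltnS => kt.
    case: k kt => // k kt; exact: (p2_dvd_nrm p_pr p2 (zP k.+1 kt) (NE k.+1 kt) pF pF').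
  by move/valM; lia.
exists N, (fun k => exists s, ev F (w ^+ (p ^ (t - k)))^* =
  - (w ^+ (p ^ (t - k))) ^+ s * ev F (w ^+ (p ^ (t - k)))); split.
- by rewrite NM dvdz_mull.
- move=> k kt; have NEk := NE k kt; have N0k := N0 k kt.
  case: k kt NEk N0k => // k kt NEk N0k.
  exact: (prime_power_or_conj p_pr p2 (zP _ kt) NEk N0k pF pF').
- move=> ks uks ksP big; apply: valM; rewrite NM expnD PoszM dvdz_mul //.
  exact: (bad_dvd p_pr p2 wn pF pF' uks ksP big).
- move=> ks uks ksP ks2 sks bad1; rewrite -addSn; apply: valM; rewrite NM expnD PoszM dvdz_mul //.
  exact: (bad_dvd_with1 p_pr p2 wn pF pF' uks ksP ks2 sks t0 bad1).
Qed.

Lemma factors_large p t j (m : int) : prime p -> (2 < p)%N -> (0 < t)%N ->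
  (t + 1 <= j < 2 * t)%N -> (4 < p)%N \/ (t + 1 < j)%N ->
  ~~ (p%:Z %| m)%Z -> circ_dets (p ^ t) (p%:Z ^+ j * m) ->
  exists q a : nat -> nat,
    (forall i, (1 <= i < 1 + (2 * t - j))%N ->
       [/\ prime (q i), odd (a i) & (q i ^ a i = 1 %[mod p ^ i])%N]) /\
    ((\prod_(1 <= i < 1 + (2 * t - j)) (q i ^ a i)%N)%:Z %| m)%Z.
Proof.
move=> p_pr p2 t0 /andP[j1 j2] big pm dm.
have jt : (0 < j < 2 * t)%N by lia.
have [N [bad [Nm gb b1 b2]]] := circ_dets_structure p_pr p2 t0 jt pm dm.
have [|G [B [sG uB sz GP BP]]] := @split_range (good p N) bad 1 t.
  by move=> k; rewrite add1n ltnS; apply: gb.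
have GP' k : k \in G -> (1 <= k <= t)%N /\ good p N k by move/GP.
have BP' k : k \in B -> (0 < k <= t)%N /\ bad k by move/BP.
apply: (good_factors p_pr _ sG GP' _ Nm) => //.
suff : (size B + t <= j)%N by move: (size G) (size B) sz => x y; lia.
have [p4|p4] := boolP (4 < p)%N; first by apply: b1 => //; left.
have {}big : (t + 1 < j)%N by case: big => // p4'; rewrite p4' in p4.
(* Only p = 3 remains; level 1 is counted apart. *)
pose ks := rem 1%N B.
have uks : uniq ks by exact: rem_uniq.
have ksP k : k \in ks -> (0 < k <= t)%N /\ bad k by move/mem_rem/BP'.
have ks2 k : k \in ks -> (1 < k)%N.
  move=> kks; have [/andP[k0 _] _] := ksP k kks.
  by move: kks; rewrite /ks (rem_filter _ uB) mem_filter /= => /andP[k1 _]; rewrite ltn_neqAle eq_sym k1.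
have [B1|B1] := boolP (1%N \in B); last first.
  by rewrite -[B](_ : ks = B); [apply: b1 => //; right | rewrite /ks rem_id].
have szB : size B = (size ks).+1.
  by rewrite /ks size_rem // prednK //; case: (B) B1.
have [_ bad1] := BP' _ B1.
(* The case escaping [b2]: here [B] has two levels, and j > t + 1 already leaves room for them. *)
have [s1|s1] := eqVneq (size ks) 1%N; first by rewrite szB s1; lia.
by have := b2 ks uks ksP ks2 s1 bad1; rewrite szB addSn.
Qed.

(** Without level 1 there are t - 1 levels, and j = t + 1 allows one bad level among them: t - 2
    prime powers remain, indexed from 2. *)
Lemma factors_three t (m : int) : (2 < t)%N ->
  ~~ (3%:Z %| m)%Z -> circ_dets (3 ^ t) (3%:Z ^+ (t + 1) * m) ->
  exists q a : nat -> nat,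
    (forall i, (2 <= i < 2 + (t - 2))%N ->
       [/\ prime (q i), odd (a i) & (q i ^ a i = 1 %[mod 3 ^ i])%N]) /\
    ((\prod_(2 <= i < 2 + (t - 2)) (q i ^ a i)%N)%:Z %| m)%Z.
Proof.
move=> t2 pm dm.
have jt : (0 < t + 1 < 2 * t)%N by lia.
have t0 : (0 < t)%N by lia.
have [N [bad [Nm gb b1 _]]] := circ_dets_structure (isT : prime 3) isT t0 jt pm dm.
have lt_t k : (2 <= k < 2 + t.-1)%N -> (2 <= k <= t)%N by lia.
have [|G [B [sG uB sz GP BP]]] := @split_range (good 3 N) bad 2 t.-1.
  by move=> k /lt_t /andP[k2 kt]; apply: gb; rewrite kt ltnW.
have GP' k : k \in G -> (2 <= k <= t)%N /\ good 3 N k by case/GP=> /lt_t.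
apply: (good_factors _ _ sG GP' _ Nm) => //.
have : (size B + t <= t + 1)%N.
  apply: b1 => // [k /BP [/lt_t /andP[k2 kt] bk]|]; first by rewrite kt ltnW.
  by right=> k /BP [/andP[]].
by move: (size G) (size B) sz => x y; lia.
Qed.

Theorem theorem1p1 (p t : nat) :
  prime p ->
  ((5 <= p)%N /\ (2 <= t)%N \/ p = 3%N /\ (3 <= t)%N) ->
  (* p^(2t) Z is contained in S(Z_(p^t)) *)
  (forall k : int, circ_dets (p ^ t) ((p%:Z) ^+ (2 * t) * k)) /\
  (* p^j is not in S(Z_(p^t)) for t+1 <= j <= 2t-1 *)
  (forall j : nat, (t + 1 <= j <= 2 * t - 1)%N ->
     ~ circ_dets (p ^ t) ((p%:Z) ^+ j)) /\
  (forall (j : nat) (m : int),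
     (t + 1 <= j <= 2 * t - 1)%N -> ~~ (p%:Z %| m)%Z ->
     circ_dets (p ^ t) ((p%:Z) ^+ j * m) ->
     (* (a) *)
     (((5 <= p)%N \/ (p = 3%N /\ (t + 1 < j)%N)) ->
       exists q a : nat -> nat,
         (forall i : nat, (1 <= i <= 2 * t - j)%N ->
            [/\ prime (q i), odd (a i) &
                (q i ^ a i = 1 %[mod p ^ i])%N]) /\
         ((\prod_(1 <= i < (2 * t - j).+1) (q i ^ a i)%N)%:Z %| m)%Z) /\
     (* (b) *)
     ((p = 3%N /\ j = (t + 1)%N) ->
       exists q a : nat -> nat,
         (forall i : nat, (2 <= i <= t - 1)%N ->
            [/\ prime (q i), odd (a i) &
                (q i ^ a i = 1 %[mod 3 ^ i])%N]) /\
         ((\prod_(2 <= i < t) (q i ^ a i)%N)%:Z %| m)%Z)).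
Proof.
move=> p_pr pt.
have p2 : (2 < p)%N by case: pt => [[p5 _]|[-> //]]; exact: ltnW (ltnW p5).
have t1 : (1 < t)%N by case: pt => [[_ //]|[_]]; exact: ltnW.
have p_odd : odd p by case: (even_prime p_pr) => // p2'; rewrite p2' in p2.
have pa j m : (t + 1 <= j <= 2 * t - 1)%N -> ~~ (p%:Z %| m)%Z ->
  circ_dets (p ^ t) ((p%:Z) ^+ j * m) -> (5 <= p)%N \/ (p = 3%N /\ (t + 1 < j)%N) ->
  exists q a : nat -> nat,
    (forall i : nat, (1 <= i <= 2 * t - j)%N ->
       [/\ prime (q i), odd (a i) & (q i ^ a i = 1 %[mod p ^ i])%N]) /\
    ((\prod_(1 <= i < (2 * t - j).+1) (q i ^ a i)%N)%:Z %| m)%Z.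
  move=> jt pm dm H; have jt' : (t + 1 <= j < 2 * t)%N by lia.
  have big : (4 < p)%N \/ (t + 1 < j)%N by case: H => [|[]]; [left | right].
  exact: (factors_large p_pr p2 (ltnW t1) jt' big pm dm).
have pb m : p = 3%N -> (2 < t)%N -> ~~ (p%:Z %| m)%Z ->
  circ_dets (p ^ t) ((p%:Z) ^+ (t + 1) * m) ->
  exists q a : nat -> nat,
    (forall i : nat, (2 <= i <= t - 1)%N ->
       [/\ prime (q i), odd (a i) & (q i ^ a i = 1 %[mod 3 ^ i])%N]) /\
    ((\prod_(2 <= i < t) (q i ^ a i)%N)%:Z %| m)%Z.
  move=> -> t2 pm dm; have [q [a [H D]]] := factors_three t2 pm dm.
  exists q, a; split; first by move=> i it; apply: H; lia.
  by rewrite -[X in \prod_(2 <= i < X) _](subnKC (ltnW t2)).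
(* For m = 1 the first prime power would divide 1, although its odd exponent is positive. The index
   ranges are nonempty since j < 2t, respectively t > 2. *)
have no_unit lo hi (q a : nat -> nat) : (lo < hi)%N ->
    prime (q lo) -> odd (a lo) -> ~ ((\prod_(lo <= i < hi) (q i ^ a i)%N)%:Z %| 1%:Z)%Z.
  move=> lh qp ao; rewrite big_ltn // dvdzE /= dvdn1 muln_eq1 => /andP[/eqP H _].
  have : (q lo ^ 1 <= q lo ^ a lo)%N by rewrite leq_exp2l ?prime_gt1 // odd_gt0.
  by rewrite H expn1 leqNgt prime_gt1.
have p1 : ~~ (p%:Z %| 1)%Z by rewrite dvdzE /= dvdn1 gtn_eqF // prime_gt1.
split; [|split].
- move=> k; have := @circ_dets_multiple_sq (p ^ t) k; rewrite oddX p_odd orbT => /(_ isT).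
  by rewrite mulnC exprM -[(p ^ t)%N%:Z]natz natrX natz.
- move=> j jt dj; have dj' : circ_dets (p ^ t) (p%:Z ^+ j * 1) by rewrite mulr1.
  have [H|[H1 H2]] : ((5 <= p)%N \/ (p = 3%N /\ (t + 1 < j)%N)) \/ (p = 3%N /\ j = (t + 1)%N).
    case: pt => [[-> _]|[-> _]]; first by left; left.
    by have [h|h] := ltnP (t + 1) j; [left; right | right; split=> //; lia].
  + have [q [a [qa D]]] := pa j 1 jt p1 dj' H.
    have [|q1 a1 _] := qa 1%N; first by lia.
    by apply: (no_unit 1%N _ q a _ q1 a1 D); lia.
  + have t2 : (2 < t)%N by case: pt => [[]|[]//]; rewrite H1.
    rewrite H2 in dj'; have [q [a [qa D]]] := pb 1 H1 t2 p1 dj'.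
    have [|q1 a1 _] := qa 2; first by lia.
    by apply: (no_unit 2 _ q a _ q1 a1 D).
- move=> j m jt pm dm; split; first exact: pa.
  move=> [H1 H2]; apply: pb => //; last by rewrite -H2.
  by case: pt => [[]|[]//]; rewrite H1.
Qed.
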